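(* Given $q\in\operatorname{Quat}_{n+1}$, a reduced word $a_{i_1}\cdots a_{i_k}\in S_{n+1}$, and signs $\varepsilon_1,\ldots,\varepsilon_k\in\{\pm1\}$, the map $$\Psi:(0,\pi)^k\to\operatorname{Bru}_{q(\acute a_{i_1})^{\varepsilon_1}\cdots(\acute a_{i_k})^{\varepsilon_k}},\qquad \Psi(\theta_1,\ldots,\theta_k)=q\,\alpha_{i_1}(\varepsilon_1\theta_1)\cdots\alpha_{i_k}(\varepsilon_k\theta_k),$$ is a diffeomorphism.
   Context: Fix an integer $n\ge2$. $S_{n+1}$ is the group of permutations of $\{1,\ldots,n+1\}$ acting on the right, $(\sigma,k)\mapsto k^\sigma$, so $k^{\sigma_1\sigma_2}=(k^{\sigma_1})^{\sigma_2}$; it is generated by $a_j=(j,j+1)$, $1\le j\le n$. $\operatorname{inv}(\sigma)$ is the number of pairs $i<j$ with $i^\sigma>j^\sigma$; a reduced word for $\sigma$ is an expression $\sigma=a_{i_1}\cdots a_{i_k}$ with $k=\operatorname{inv}(\sigma)$. $\Pi:\operatorname{Spin}_{n+1}\to\operatorname{SO}_{n+1}$ is the universal (double) covering homomorphism. Let $\mathfrak a_j\in\mathfrak{so}_{n+1}$ have nonzero entries only $(\mathfrak a_j)_{j+1,j}=1$, $(\mathfrak a_j)_{j,j+1}=-1$. Identifying the Lie algebra of $\operatorname{Spin}_{n+1}$ with $\mathfrak{so}_{n+1}$ via $\Pi$, let $\alpha_j(\theta)=\exp(\theta\mathfrak a_j)\in\operatorname{Spin}_{n+1}$ and $\acute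 a_j=\alpha_j(\pi/2)$. $\mathrm B^+_{n+1}\subset\operatorname{SO}_{n+1}$ is the group of signed permutation matrices of determinant $1$; for such $P$, $\sigma_P\in S_{n+1}$ is defined by $e_j^\top P=\pm e_{j^{\sigma_P}}^\top$ for all $j$. $\operatorname{Diag}^+_{n+1}\subset \mathrm B^+_{n+1}$ is the subgroup of diagonal matrices. $\widetilde{\mathrm B}^+_{n+1}=\Pi^{-1}[\mathrm B^+_{n+1}]$ (it contains the $\acute a_j$), $\operatorname{Quat}_{n+1}=\Pi^{-1}[\operatorname{Diag}^+_{n+1}]$. $\operatorname{Up}^+_{n+1}$ is the group of real upper triangular $(n+1)\times(n+1)$ matrices with strictly positive diagonal entries. For $z\in\widetilde{\mathrm B}^+_{n+1}$ with $P=\Pi(z)$, the signed Bruhat cell $\operatorname{Bru}_z\subset\operatorname{Spin}_{n+1}$ is the connected component containing $z$ of $\Pi^{-1}\big[(\operatorname{Up}^+_{n+1}P\operatorname{Up}^+_{n+1})\cap\operatorname{SO}_{n+1}\big]$; it is a contractible smooth submanifold of dimension $\operatorname{inv}(\sigma_P)$. *)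

(* Defs.v *)
From HB Require Import structures.
From mathcomp Require Import all_boot all_order all_algebra perm.
From mathcomp Require Import all_classical all_reals all_analysis.

Set Implicit Arguments.
Unset Strict Implicit.
Unset Printing Implicit Defensive.

Import Order.TTheory GRing.Theory Num.Theory.
Import numFieldNormedType.Exports.

Local Open Scope classical_set_scope.
Local Open Scope ring_scope.

HB.mixin Record Group_Topological_isTopGroup G of Group G & Topological G := {
  mulg_continuous : continuous (fun x : G * G => (x.1 * x.2)%g);
  invg_continuous : continuous (fun x : G => (x^-1)%g)
}.

#[short(type="topGroupType")]
HB.structure Definition TopGroup :=
  {G of Group G & Topological G & Group_Topological_isTopGroup G}.

Section Coverings.
Context {R : realType}.

Definition simply_connected (E : topologicalType) :=
  (forall x y : E, exists gam : R -> E,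
      [/\ {within `[0, 1], continuous gam}, gam 0 = x & gam 1 = y]) /\
  (forall gam : R -> E, {within `[0, 1], continuous gam} -> gam 0 = gam 1 ->
    exists H : R * R -> E,
      {within `[0, 1] `*` `[0, 1], continuous H} /\
      forall t : R, t \in `[0, 1] ->
        [/\ H (0, t) = gam t, H (1, t) = gam 0,
            H (t, 0) = gam 0 & H (t, 1) = gam 0]).

(* The map s is the inverse homeomorphism to p : V -> U `&` S. *)
Definition sheet (E B : topologicalType) (p : E -> B) (S U : set B)
    (V : set E) :=
  open V /\
  exists s : B -> E,
    [/\ {within U `&` S, continuous s},
        forall b, (U `&` S) b -> V (s b) /\ p (s b) = b &
        forall x, V x -> s (p x) = x].

Definition covering_map (E B : topologicalType) (p : E -> B) (S : set B) :=
  [/\ continuous p, range p = S &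
      forall b, S b -> exists2 U : set B, open U /\ U b &
        exists F : set (set E),
          [/\ trivIset F id, \bigcup_(V in F) V = p @^-1` U &
              forall V, F V -> sheet p S U V]].

Definition SO (m : nat) : set 'M[R]_m :=
  [set A | A *m A^T = 1%:M /\ \det A = 1].

(* Determines (G, Pi) up to unique isomorphism; for m >= 3 it is the double
   covering Spin_m -> SO_m. *)
Definition universal_covering_hom (m : nat) (G : topGroupType)
    (Pi : G -> 'M[R]_m) :=
  [/\ forall x y, Pi (x * y)%g = Pi x *m Pi y,
      covering_map Pi (@SO m) &
      simply_connected G].

End Coverings.

Section Smooth.
Context {R : realType}.

(* C^k on an open set U of a finite-dimensional space V. *)
Fixpoint Ck_on (V W : normedModType R) (k : nat) (U : set V) (f : V -> W) :=
  match k with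
  | 0%N => forall x, U x -> {for x, continuous f}
  | k'.+1 => (forall x, U x -> differentiable f x) /\
             forall v, Ck_on k' U (fun x => 'D_v f x)
  end.

Definition smooth_on (V W : normedModType R) (U : set V) (f : V -> W) :=
  forall k, Ck_on k U f.

(* G carries the smooth structure for which the covering Pi : G -> SO_m is a
   local diffeomorphism, SO_m being a submanifold of 'M_m.  Maps into G are thus
   smooth iff they are continuous with smooth image under Pi; functions on a
   submanifold S of G are smooth iff they locally extend to G, that is, iff they
   are locally of the form h \o Pi with h smooth on an open set of matrices. *)
Context (m : nat) (G : topGroupType) (Pi : G -> 'M[R]_m).

Definition smooth_into (V : normedModType R) (D : set V) (f : V -> G) :=
  {in D, continuous f} /\ smooth_on D (Pi \o f).

Definition smooth_from (W : normedModType R) (S : set G) (g : G -> W) :=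
  forall z, S z ->
    exists (N : set G) (O : set 'M[R]_m) (h : 'M[R]_m -> W),
      [/\ nbhs z N, open O, smooth_on O h &
          forall x, N x -> O (Pi x) /\ (S x -> g x = h (Pi x))].

Definition diffeomorphism_onto (V : normedModType R) (D : set V) (S : set G)
    (f : V -> G) :=
  [/\ set_bij D S f, smooth_into D f &
      exists2 g : G -> V, forall x, D x -> g (f x) = x & smooth_from S g].

End Smooth.

Section SpinGroup.
Context {R : realType} {m : nat} {G : topGroupType} (Pi : G -> 'M[R]_m).

(* One-parameter subgroup with initial velocity X, the Lie algebra of G being
   identified with so_m through the differential of Pi at 1. *)
Definition one_parameter_subgroup (X : 'M[R]_m) (gam : R -> G) :=
  [/\ continuous gam, forall s t, gam (s + t) = (gam s * gam t)%g &
      is_derive (0 : R) 1 (Pi \o gam) X].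

Definition lie_exp (X : 'M[R]_m) : G :=
  xget 1%g [set x | exists2 gam, one_parameter_subgroup X gam & gam 1 = x].

(* The rows of A satisfy e_j^T A = +/- e_{j^s}^T. *)
Definition Bplus : set 'M[R]_m :=
  [set A | (exists s : {perm 'I_m}, forall j,
              row j A = delta_mx 0 (s j) \/ row j A = - delta_mx 0 (s j))
           /\ \det A = 1].

Definition Diagplus : set 'M[R]_m := Bplus `&` [set A | is_diag_mx A].

Definition Quat : set G := Pi @^-1` Diagplus.

Definition Upplus : set 'M[R]_m :=
  [set A | (forall i j : 'I_m, (j < i)%N -> A i j = 0) /\ forall i, 0 < A i i].

Definition Bruhat_cell (P : 'M[R]_m) : set 'M[R]_m :=
  [set A | exists U1 U2, [/\ Upplus U1, Upplus U2 & A = U1 *m P *m U2]].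

Definition Bru (z : G) : set G :=
  connected_component (Pi @^-1` (Bruhat_cell (Pi z) `&` SO (m := m))) z.

End SpinGroup.

Section Generators.
Context {n : nat}.

(* For j : 'I_n, the indices j and j + 1 of 'I_n.+1. *)
Definition idx0 (j : 'I_n) : 'I_n.+1 := widen_ord (leqnSn n) j.
Definition idx1 (j : 'I_n) : 'I_n.+1 := lift ord0 j.

Definition adj_transp (j : 'I_n) : {perm 'I_n.+1} := tperm (idx0 j) (idx1 j).

Definition inversions (s : {perm 'I_n.+1}) : nat :=
  #|[set p : 'I_n.+1 * 'I_n.+1 | (p.1 < p.2)%N && (s p.2 < s p.1)%N]|.

(* The product of permutations is that of the right action:
   (s1 * s2) x = s2 (s1 x). *)
Definition reduced_word (k : nat) (w : 'I_k -> 'I_n) :=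
  inversions (\prod_(j < k) adj_transp (w j))%g = k.

Context {R : realType} {G : topGroupType} (Pi : G -> 'M[R]_n.+1).

Definition so_gen (j : 'I_n) : 'M[R]_n.+1 :=
  delta_mx (idx1 j) (idx0 j) - delta_mx (idx0 j) (idx1 j).

Definition alpha (j : 'I_n) (t : R) : G := lie_exp Pi (t *: so_gen j).

Definition acute (j : 'I_n) : G := alpha j (pi / 2).

End Generators.

(* Signs are encoded by booleans, b standing for (-1) ^+ b. *)
Definition sign_pow (G : groupType) (x : G) (b : bool) : G :=
  if b then (x^-1)%g else x.

Definition cube {R : realType} (k : nat) : set 'rV[R]_k :=
  [set t | forall j, 0 < t ord0 j < pi].

(* Main.v *)
Require Import Defs.
From mathcomp Require Import all_boot all_order all_algebra perm.
From mathcomp Require Import all_classical all_reals all_analysis.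
From mathcomp Require Import ring lra zify.

Set Implicit Arguments.
Unset Strict Implicit.
Unset Printing Implicit Defensive.

Import Order.TTheory GRing.Theory Num.Theory.
Import numFieldNormedType.Exports.

Local Open Scope classical_set_scope.
Local Open Scope ring_scope.

(** Everything is reduced to matrices.  Write [R_i(t)] for the rotation
    [plane_rot i t = exp (t a_i)] and [U] for [Upplus].

    One letter.  Let [P] be a signed permutation matrix with permutation
    [sigma], let [e = 1] or [e = -1], and suppose that [sigma a_i] has one
    inversion more than [sigma].  Then
<<
      (B, t) |-> B R_i(e t),   B in U P U,   0 < t < pi,
>>
    is a bijection onto [U P R_i(e pi/2) U].  Its image is in this cell because
    the 2x2 Bruhat decomposition of [u R_i(e t)], for [u] upper triangular, has
    left factor [1 + v E_(i,i+1)], which [P] conjugates to an upper triangular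
    matrix exactly when the length goes up ([cell_rot]).  It is onto by the 2x2
    RQ decomposition of [R_i(e pi/2) u] ([cell_unrot]).  Finally [t] is
    recovered from [A = B R_i(e t)]: let [b] be the row in which [P] has its
    entry of column [i+1].  Modulo the columns of index less than [i] and the
    basis vectors of index less than [b], the column [i] of [B] vanishes, so the
    columns [i] and [i+1] of [A] are [e sin t] and [cos t] times the same vector.
    Hence [cot t] is, near each point of the cell, a quotient of two
    determinants in the entries of [A] ([frame_det_rot], [frame_det_neq0]): this
    gives uniqueness and smoothness at once ([cell_angle_smooth]).

    Induction on the word.  Every prefix of a reduced word is reduced
    ([reduced_wordS]), and an orthogonal matrix in the cell of a diagonal sign
    matrix [Q] is [Q] itself ([cell_diag_orthogonal]).  So the product of
    rotations maps the cube bijectively onto the orthogonal part of the cell of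
    its value at the centre of the cube, with an inverse that extends locally to
    a smooth function of the matrix entries ([rot_prod_cell], [rot_prod_surj],
    [rot_prod_local_inverse]).

    Lifting.  The covering is injective near the identity; this yields
    [alpha_i], a continuous homomorphism with [Pi (alpha_i t) = R_i(t)]
    ([alphaP]).  Thus [Pi \o Psi] is the product of rotations above, and it
    remains to identify the image of [Psi] with a connected component.  It lies
    in one, since the cube is connected ([Psi_Bru]).  For [y] over the cell
    let [Psi (angles y)] be the point of the image of [Psi] with the same
    projection; then [y (Psi (angles y))^-1] is continuous in [y], takes its
    values in the discrete kernel of [Pi], and equals 1 at the base point, so it
    is 1 on the whole component ([Bru_Psi]). *)

(** * Smooth functions *)

Section SmoothCalculus.
Context {R : realType}.
Implicit Types (V W : normedModType R).

Lemma near_eq_differentiable V W (f g : V -> W) x :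
  (\near x, f x = g x) -> differentiable f x -> differentiable g x.
Proof.
move=> fg df.
pose e y := g y - f y.
suff de : differentiable e x.
  by rewrite (_ : g = e + f); [exact: differentiableD|apply/funext => y; rewrite fctE /e subrK].
have e0 : \forall y \near x, e y = 0.
  by apply: filterS fg => y fgy; rewrite /e fgy addrN.
have ex0 : e x = 0 by exact: nbhs_singleton e0.
have E : e \o shift x = cst (e x) + (0 : V -> W) +o_ 0 id.
  apply/eqaddoP => eps eps0.
  move: e0; rewrite (near_shift 0) subr0; apply: filterS => y /= ey.
  have -> : (e \o shift x - (cst (e x) + 0)) y = 0.
    by rewrite !fctE /= ey ex0 addr0 oppr0 addr0.
  by rewrite normr0 mulr_ge0// ltW.
have [c _] := (@dcst R V W 0 x).
have D0 : 'd e x = 0 :> (V -> W) by exact/diff_unique.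
by apply/diff_locallyP; rewrite D0.
Qed.

(** A closed form of a derivative holds on [U] only, and may replace it in [Ck_on]
    because [U] is open. *)
Lemma Ck_on_eq V W k (U : set V) (f g : V -> W) :
  open U -> (forall x, U x -> f x = g x) -> Ck_on k U f -> Ck_on k U g.
Proof.
move=> oU; elim: k f g => [|k IH] f g fg /=.
  move=> cf x Ux; move: (cf x Ux); rewrite /prop_for /continuous_at fg//.
  apply: cvg_trans.
  apply: near_eq_cvg; apply: filterS (open_nbhs_nbhs (conj oU Ux)) => y; exact: fg.
move=> [df Df].
have nfg x : U x -> \forall y \near x, f y = g y.
  by move=> Ux; apply: filterS (open_nbhs_nbhs (conj oU Ux)) => y; exact: fg.
split=> [x Ux|v]; first by apply: near_eq_differentiable (df x Ux); exact: nfg.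
by apply: IH (Df v) => x Ux; apply: near_eq_derive; exact: nfg.
Qed.

Lemma Ck_onW V W k (U : set V) (f : V -> W) : Ck_on k.+1 U f -> Ck_on k U f.
Proof.
elim: k f => [|k IH] f /= [df Df]; first by move=> x Ux; exact/differentiable_continuous/df.
by split=> // v; apply: IH; exact: Df.
Qed.

Lemma Ck_on_sub V W k (U U' : set V) (f : V -> W) :
  U' `<=` U -> Ck_on k U f -> Ck_on k U' f.
Proof.
move=> UU; elim: k f => [|k IH] f /=; first by move=> + x Ux; apply; exact: UU.
by move=> [df Df]; split=> [x /UU /df//|v]; exact: IH.
Qed.

Lemma Ck_on_cst V W k (U : set V) (c : W) : open U -> Ck_on k U (fun=> c).
Proof.
move=> oU; elim: k c => [|k IH] c /=; first by move=> x _; exact: cst_continuous.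
split=> [x _|v]; first exact: differentiable_cst.
by apply: Ck_on_eq (IH 0) => // x _; rewrite derive_cst.
Qed.

Lemma Ck_onD V W k (U : set V) (f g : V -> W) : open U ->
  Ck_on k U f -> Ck_on k U g -> Ck_on k U (fun x => f x + g x).
Proof.
move=> oU; elim: k f g => [|k IH] f g /=.
  by move=> cf cg x Ux; apply: continuousD; [exact: cf|exact: cg].
move=> [df Df] [dg Dg]; split=> [x Ux|v].
  by apply: differentiableD; [exact: df|exact: dg].
apply: Ck_on_eq (IH _ _ (Df v) (Dg v)) => // x Ux.
by rewrite -deriveD//; apply: diff_derivable; [exact: df|exact: dg].
Qed.

Lemma Ck_onM V k (U : set V) (f g : V -> R) : open U ->
  Ck_on k U f -> Ck_on k U g -> Ck_on k U (fun x => f x * g x).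
Proof.
move=> oU; elim: k f g => [|k IH] f g.
  by move=> cf cg x Ux; apply: continuousM; [exact: cf|exact: cg].
move=> fk gk; have [fk' gk'] := (Ck_onW fk, Ck_onW gk).
move: fk gk => /= [df Df] [dg Dg]; split=> [x Ux|v].
  by apply: differentiableM; [exact: df|exact: dg].
apply: Ck_on_eq (Ck_onD oU (IH _ _ fk' (Dg v)) (IH _ _ gk' (Df v))) => // x Ux.
by rewrite -deriveM//; apply: diff_derivable; [exact: df|exact: dg].
Qed.

Lemma Ck_on_sum V W k (U : set V) (I : Type) (r : seq I) (P : pred I)
    (f : I -> V -> W) : open U ->
  (forall i, Ck_on k U (f i)) -> Ck_on k U (fun x => \sum_(i <- r | P i) f i x).
Proof.
move=> oU fk; elim: r => [|i r IH].
  by apply: Ck_on_eq (Ck_on_cst k 0 oU) => // x _; rewrite big_nil.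
have := Ck_onD oU (fk i) IH.
case E : (P i) => h; last by apply: Ck_on_eq IH => // x _; rewrite big_cons E.
by apply: Ck_on_eq h => // x _; rewrite big_cons E.
Qed.

Lemma Ck_on_prod V k (U : set V) (I : Type) (r : seq I) (P : pred I)
    (f : I -> V -> R) : open U ->
  (forall i, Ck_on k U (f i)) -> Ck_on k U (fun x => \prod_(i <- r | P i) f i x).
Proof.
move=> oU fk; elim: r => [|i r IH].
  by apply: Ck_on_eq (@Ck_on_cst V R k U 1 oU) => // x _; rewrite big_nil.
have := Ck_onM oU (fk i) IH.
case E : (P i) => h; last by apply: Ck_on_eq IH => // x _; rewrite big_cons E.
by apply: Ck_on_eq h => // x _; rewrite big_cons E.
Qed.

Lemma Ck_on_det V k (U : set V) n (f : V -> 'M[R]_n) : open U ->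
  (forall i j, Ck_on k U (fun x => f x i j)) -> Ck_on k U (fun x => \det (f x)).
Proof.
move=> oU fk; apply: Ck_on_sum => // s; apply: Ck_onM => //.
  exact: Ck_on_cst.
exact: Ck_on_prod.
Qed.

Lemma Ck_on_coord k m n (i : 'I_m) (j : 'I_n) (U : set 'M[R]_(m, n)) : open U ->
  Ck_on k U (fun A : 'M[R]_(m, n) => A i j).
Proof.
move=> oU; case: k => [|k] /=; first by move=> x _; exact: coord_continuous.
split=> [x _|v]; first exact: differentiable_coord.
apply: Ck_on_eq (Ck_on_cst k (v i j) oU) => // x Ux.
have dx : derivable id x v by exact: derivable_id.
by have := derive_mx dx; rewrite derive_id => /matrixP/(_ i j); rewrite mxE.
Qed.

Lemma differentiable_mx V m n (f : V -> 'M[R]_(m, n)) x :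
  (forall i j, differentiable (fun x => f x i j) x) -> differentiable f x.
Proof.
move=> df.
have -> : f = \sum_(i < m) (\sum_(j < n) fun x => f x i j *: delta_mx i j).
  apply/funext => y; rewrite fct_sumE {1}(matrix_sum_delta (f y)).
  by apply: eq_bigr => i _; rewrite fct_sumE.
apply: differentiable_sum => i; apply: differentiable_sum => j.
exact: differentiableZl.
Qed.

Lemma Ck_on_mx V k (U : set V) m n (f : V -> 'M[R]_(m, n)) : open U ->
  (forall i j, Ck_on k U (fun x => f x i j)) -> Ck_on k U f.
Proof.
move=> oU; elim: k f => [|k IH] f /= fk.
  move=> x Ux. apply/cvgrPdist_le => /= e e0.
  near=> y.
  rewrite /Num.Def.normr/= mx_normrE (bigmax_le _ (ltW e0))//= => i _.
  rewrite !mxE/=.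
  move: i; near: y; apply: filter_forall => /= i.
  exact: ((cvgrPdist_le _ _).1 (fk i.1 i.2 x Ux)).
have df x : U x -> differentiable f x.
  by move=> Ux; apply: differentiable_mx => i j; have [+ _] := fk i j; apply.
split=> // v.
apply: (@Ck_on_eq _ _ _ _ (fun x => \matrix_(i, j) 'D_v (fun x => f x i j) x)) => //.
  by move=> x Ux; rewrite derive_mx//; exact/diff_derivable/df.
apply: IH => i j; have [_ /(_ v)] := fk i j.
by apply: Ck_on_eq => // x Ux; rewrite mxE.
Unshelve. all: by end_near. Qed.

(** By induction on [k], from the chain rule
    [D_v (g \o f) = \sum_(i, j) D_v f_ij * (D_(E_ij) g) \o f]. *)
Lemma Ck_on_comp_mx V k (U : set V) m n (O : set 'M[R]_(m, n))
    (f : V -> 'M[R]_(m, n)) (g : 'M[R]_(m, n) -> R) : open U ->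
  (forall x, U x -> O (f x)) ->
  (forall i j, Ck_on k U (fun x => f x i j)) -> Ck_on k O g ->
  Ck_on k U (fun x => g (f x)).
Proof.
move=> oU fO; elim: k g => [|k IH] g fk gk.
  move=> x Ux; apply: continuous_comp; last exact/gk/fO.
  apply: (@Ck_on_mx V 0 U m n f oU fk x Ux).
have fk' i j : Ck_on k U (fun x => f x i j) by exact: Ck_onW.
have [df _] := Ck_on_mx oU fk.
have [dg Dg] := gk.
split=> [x Ux|v]; first exact: differentiable_comp (df x Ux) (dg _ (fO _ Ux)).
have E x : U x -> \sum_i \sum_j 'D_v (fun y => f y i j) x * 'D_(delta_mx i j) g (f x)
    = 'D_v (fun x => g (f x)) x.
  move=> Ux; have dfx := df x Ux; have dgx := dg _ (fO _ Ux).
  rewrite [RHS]deriveE; last exact: differentiable_comp.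
  rewrite (diff_comp dfx dgx)/= -(deriveE v dfx) derive_mx; last exact: diff_derivable.
  rewrite [X in 'd g (f x) X]matrix_sum_delta linear_sum; apply: eq_bigr => i _.
  rewrite linear_sum; apply: eq_bigr => j _.
  by rewrite linearZ/= mxE -deriveE.
apply: (Ck_on_eq oU E).
apply: Ck_on_sum => // i; apply: Ck_on_sum => // j; apply: Ck_onM => //.
  by have [_ Dij] := fk i j; exact: Dij.
by apply: (IH (fun y => 'D_(delta_mx i j) g y)) => //; exact: Dg.
Qed.

Lemma Ck_on_comp V k (U : set V) (O : set R) (f : V -> R) (g : R -> R) :
  open U -> (forall x, U x -> O (f x)) ->
  Ck_on k U f -> Ck_on k O g -> Ck_on k U (fun x => g (f x)).
Proof.
move=> oU fO; elim: k g => [|k IH] g fk gk.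
  by move=> x Ux; apply: continuous_comp; [exact: fk|exact/gk/fO].
have fk' : Ck_on k U f by exact: Ck_onW.
have [df Df] := fk; have [dg Dg] := gk.
split=> [x Ux|v]; first exact: differentiable_comp (df x Ux) (dg _ (fO _ Ux)).
have E x : U x -> 'D_v f x * 'D_1 g (f x) = 'D_v (fun x => g (f x)) x.
  move=> Ux; have dfx := df x Ux; have dgx := dg _ (fO _ Ux).
  rewrite [RHS]deriveE; last exact: differentiable_comp.
  rewrite (diff_comp dfx dgx)/= -(deriveE v dfx).
  by rewrite -[X in 'd g (f x) X]mulr1 linearZ/= -deriveE.
apply: (Ck_on_eq oU E); apply: Ck_onM => //; first exact: Df.
by apply: (IH (fun y => 'D_1 g y)) => //; exact: Dg.
Qed.

Lemma derive_along (f : R -> R) (x v d : R) : is_derive x 1 f d -> 'D_v f x = v * d.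
Proof.
move=> [/derivable1_diffP df <-].
by rewrite !deriveE// -[X in 'd f x X]mulr1 linearZ.
Qed.

(** For functions of one real variable, smoothness follows from a formula for
    the derivative that involves the function itself: this handles [cos], [sin],
    the inverse and [atan]. *)
Lemma Ck_on_antiderivative k (U : set R) (f g : R -> R) : open U ->
  (forall x : R, U x -> is_derive x 1 f (g x)) -> Ck_on k U g -> Ck_on k.+1 U f.
Proof.
move=> oU fg gk; split=> [x Ux|v].
  by apply/derivable1_diffP; have [] := fg x Ux.
apply: (@Ck_on_eq _ _ _ _ (fun x => v * g x)) => //.
  by move=> x /fg /derive_along ->.
by apply: Ck_onM => //; exact: Ck_on_cst.
Qed.

Lemma Ck_on_cos_sin k : Ck_on k [set: R] (@cos R) /\ Ck_on k [set: R] (@sin R).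
Proof.
elim: k => [|k [ck sk]]; first by split=> x _; [exact: continuous_cos|exact: continuous_sin].
have oT := @openT R.
split; last by apply: (@Ck_on_antiderivative _ _ _ cos) => // x _; exact: is_derive_sin.
apply: (@Ck_on_antiderivative _ _ _ (fun x => (-1) * sin x)) => //.
  by move=> x _; rewrite mulN1r; exact: is_derive_cos.
by apply: Ck_onM => //; exact: Ck_on_cst.
Qed.

Lemma Ck_on_inv k : Ck_on k [set x : R | x != 0] (@GRing.inv R).
Proof.
have oU : open [set x : R | x != 0] by exact: open_neq.
elim: k => [|k IH]; first by move=> x /= x0; exact: inv_continuous.
apply: (@Ck_on_antiderivative _ _ _ (fun x => (- 1) * (x^-1 * x^-1))) => //.
  move=> x /= x0.
  have := @is_deriveV R id x 1 1 x0 (is_derive_id x 1).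
  move=> D; apply: (is_derive_eq D).
  by rewrite [_ *: _]mulr1 -exprVn expr2 mulN1r.
by apply: Ck_onM => //; [exact: Ck_on_cst|exact: Ck_onM].
Qed.

Lemma Ck_on_atan k : Ck_on k [set: R] (@atan R).
Proof.
case: k => [|k]; first by move=> x _; exact: continuous_atan.
have oT := @openT R.
apply: (@Ck_on_antiderivative _ _ _ (fun x => (1 + x ^+ 2)^-1)) => //.
apply: (@Ck_on_comp _ _ _ _ _ _ oT _ _ (Ck_on_inv k)).
  by move=> x _ /=; rewrite gt_eqF// ltr_pwDl// sqr_ge0.
apply: Ck_onD => //; first exact: Ck_on_cst.
have Xk : Ck_on k [set: R] id.
  case: k => [|k]; first by move=> x _; exact: cvg_id.
  by apply: (@Ck_on_antiderivative _ _ _ (fun=> 1)) => // ; exact: Ck_on_cst.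
exact: Ck_onM.
Qed.

End SmoothCalculus.

(** * Reduced words *)

Section Inversions.
Context {n : nat}.
Implicit Types (s : {perm 'I_n.+1}) (i : 'I_n).

Lemma idx_neq i : (idx0 i == idx1 i) = false.
Proof. by apply/negbTE; rewrite -val_eqE /= /bump /= add1n; lia. Qed.

Lemma adj_transp_lt i (x y : 'I_n.+1) : (x < y)%N ->
  (adj_transp i y < adj_transp i x)%N -> x = idx0 i /\ y = idx1 i.
Proof.
move=> xy; rewrite /adj_transp !permE /=.
case: (eqVneq x (idx0 i)) => [x0|x0]; case: (eqVneq y (idx0 i)) => [y0|y0];
case: (eqVneq x (idx1 i)) => [x1|x1]; case: (eqVneq y (idx1 i)) => [y1|y1]; subst=> //;
move: xy; rewrite -?val_eqE /=;
  do ?(move: x0 || move: x1 || move: y0 || move: y1); rewrite -?val_eqE /= /bump /= ?add1n; lia.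
Qed.

(** The set in the definition of [inversions] is a classical set; here it is a
    finite one, to which the cardinality lemmas apply. *)
Lemma inversionsE s : inversions s =
  #|finset.finset (fun p : 'I_n.+1 * 'I_n.+1 => (p.1 < p.2)%N && (s p.2 < s p.1)%N)|.
Proof. by apply: eq_card => p; rewrite finset.in_set; exact: asboolb. Qed.

(** The only pair of values that [adj_transp i] reverses is [(i, i+1)], so the only
    pair of positions that can become an inversion is that of these values. *)
Lemma inversions_adj s i :
  (inversions (s * adj_transp i)%g <=
   inversions s + ((s^-1)%g (idx0 i) < (s^-1)%g (idx1 i))%N)%N.
Proof.
set a := (s^-1)%g _; set b := (s^-1)%g _.
pose D := if (a < b)%N then [set (a, b)]%SET else finset.set0.
have -> : ((a < b)%N : nat) = #|D| by rewrite /D; case: ifP => _; rewrite ?cards1 ?cards0.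
rewrite !inversionsE; apply: (leq_trans _ (leq_of_leqif (leq_card_setU _ D))).
apply/subset_leq_card/fintype.subsetP => -[p q]; rewrite !inE /= !permM => /andP[pq tpq].
rewrite pq /=; case: (ltngtP (s q) (s p)) => //= [spq|/val_inj/perm_inj qp].
  have [sp sq] := adj_transp_lt spq tpq.
  have pa : p = a by rewrite /a -sp permK.
  have qb : q = b by rewrite /b -sq permK.
  by rewrite /D -pa -qb pq inE.
by rewrite qp ltnn in pq.
Qed.

Lemma inversions1 : inversions (1 : {perm 'I_n.+1})%g = 0%N.
Proof.
rewrite inversionsE; apply: eq_card0 => -[p q]; rewrite finset.in_set /= !perm1.
by apply/negbTE; lia.
Qed.

Lemma inversions_word k (w : 'I_k -> 'I_n) :
  (inversions (\prod_(j < k) adj_transp (w j))%g <= k)%N.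
Proof.
elim: k w => [|k IH] w; first by rewrite big_ord0 inversions1.
rewrite big_ord_recr /=; apply: leq_trans (inversions_adj _ _) _.
by rewrite -[X in (_ <= X)%N]addn1; apply: leq_add (leq_b1 _); exact: IH.
Qed.

(** A last letter that lengthens the prefix does so because the prefix shows the
    value [i] before the value [i+1]. *)
Lemma reduced_wordS k (w : 'I_k.+1 -> 'I_n) (w' := fun j => w (widen_ord (leqnSn k) j))
    (s := (\prod_(j < k) adj_transp (w' j))%g) : reduced_word w ->
  reduced_word w' /\ ((s^-1)%g (idx0 (w ord_max)) < (s^-1)%g (idx1 (w ord_max)))%N.
Proof.
rewrite /reduced_word big_ord_recr /= => E; rewrite -/s.
have := inversions_adj s (w ord_max); rewrite [inversions (_ * _)%g]E.
have := inversions_word w'; rewrite -/s /reduced_word -/s => H1.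
case: (s^-1%g _ < _)%N => /=; rewrite ?addn1 ?addn0 ?ltnS => H2; last by move: (leq_trans H2 H1); rewrite ltnn.
by split=> //; apply/eqP; rewrite eqn_leq H1 H2.
Qed.

End Inversions.

(** * Matrices acting in a coordinate plane *)

Section Block.
Context {R : realType} {n : nat}.
Implicit Types (i : 'I_n) (U A B P : 'M[R]_n.+1).

Definition plane_mx i (a b c d : R) : 'M[R]_n.+1 := \matrix_(p, q)
  if p == idx0 i then if q == idx0 i then a else if q == idx1 i then b else 0
  else if p == idx1 i then if q == idx0 i then c else if q == idx1 i then d else 0
  else (p == q)%:R.

Lemma sum_plane i (F : 'I_n.+1 -> R) :
  (forall p, p != idx0 i -> p != idx1 i -> F p = 0) ->
  \sum_p F p = F (idx0 i) + F (idx1 i).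
Proof.
move=> F0; rewrite (bigD1 (idx0 i)) //= (bigD1 (idx1 i)) /= ?big1 ?addr0 //.
  by move=> p /andP[]; exact: F0.
by rewrite eq_sym idx_neq.
Qed.

Lemma plane_mx_mulE i a b c d U p q : (plane_mx i a b c d *m U) p q =
  if p == idx0 i then a * U (idx0 i) q + b * U (idx1 i) q
  else if p == idx1 i then c * U (idx0 i) q + d * U (idx1 i) q else U p q.
Proof.
rewrite mxE; case: ifP => [p0|p0]; first by
  rewrite (sum_plane (i := i)) ?mxE ?p0 ?eqxx ?[idx1 i == _]eq_sym ?idx_neq // => j j0 j1;
  rewrite mxE p0 (negbTE j0) (negbTE j1) mul0r.
case: ifP => [p1|p1]; first by
  rewrite (sum_plane (i := i)) ?mxE ?p0 ?p1 ?eqxx ?[idx1 i == _]eq_sym ?idx_neq // => j j0 j1;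
  rewrite mxE p0 p1 (negbTE j0) (negbTE j1) mul0r.
rewrite (bigD1 p) //= big1 ?addr0 => [|j jp]; rewrite mxE p0 p1 ?eqxx ?mul1r //.
by rewrite eq_sym (negbTE jp) mul0r.
Qed.

Lemma mul_plane_mxE i a b c d U p q : (U *m plane_mx i a b c d) p q =
  if q == idx0 i then U p (idx0 i) * a + U p (idx1 i) * c
  else if q == idx1 i then U p (idx0 i) * b + U p (idx1 i) * d else U p q.
Proof.
rewrite mxE; case: ifP => [p0|p0]; first by
  rewrite (sum_plane (i := i)) ?mxE ?p0 ?eqxx ?[idx1 i == _]eq_sym ?idx_neq // => j j0 j1;
  rewrite mxE (negbTE j0) (negbTE j1) (eqP p0) (negbTE j0) mulr0.
case: ifP => [p1|p1]; first by
  rewrite (sum_plane (i := i)) ?mxE ?p0 ?p1 ?eqxx ?[idx1 i == _]eq_sym ?idx_neq // => j j0 j1;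
  rewrite mxE (negbTE j0) (negbTE j1) (eqP p1) (negbTE j1) mulr0.
rewrite (bigD1 q) //= big1 ?addr0 => [|j jp]; rewrite mxE ?p0 ?p1 ?eqxx ?mulr1 //.
by rewrite (negbTE jp); do 2?case: ifP => _; rewrite mulr0.
Qed.

Lemma plane_mx_mul i a b c d a' b' c' d' :
  plane_mx i a b c d *m plane_mx i a' b' c' d' =
  plane_mx i (a * a' + b * c') (a * b' + b * d') (c * a' + d * c') (c * b' + d * d').
Proof.
apply/matrixP => p q; rewrite plane_mx_mulE !mxE !eqxx [idx1 i == _]eq_sym idx_neq /=.
have H (x y z u v w : R) : x * (if q == idx0 i then y else if q == idx1 i then z else 0)
    + u * (if q == idx0 i then v else if q == idx1 i then w else 0) =
    if q == idx0 i then x * y + u * v else if q == idx1 i then x * z + u * w else 0.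
  by case: ifP => // _; case: ifP => // _; rewrite !mulr0 addr0.
rewrite !H; case: (p == idx0 i) => //; by case: (p == idx1 i).
Qed.

Lemma plane_mx1 i : plane_mx i 1 0 0 1 = 1%:M.
Proof.
apply/matrixP => p q; rewrite !mxE.
case: ifP => [/eqP ->|p0]; first by rewrite eq_sym; case: ifP => // _; case: ifP.
case: ifP => [/eqP ->|p1] //; rewrite [idx1 i == _]eq_sym.
by case: (eqVneq q (idx0 i)) => [->|_]; [rewrite idx_neq|case: ifP].
Qed.

Lemma tr_plane_mx i a b c d : (plane_mx i a b c d)^T = plane_mx i a c b d.
Proof.
apply/matrixP => p q; rewrite !mxE [q == p]eq_sym.
case: (eqVneq p (idx0 i)) => [->|p0].
  case: (eqVneq q (idx0 i)) => [_|q0]; first by rewrite ?eqxx.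
  case: (eqVneq q (idx1 i)) => [_|q1]; first by rewrite ?eqxx.
  by [].

case: (eqVneq p (idx1 i)) => [->|p1].
  case: (eqVneq q (idx0 i)) => [_|q0]; first by rewrite ?eqxx.
  case: (eqVneq q (idx1 i)) => [_|q1]; first by rewrite ?eqxx.
  by [].
case: (eqVneq q (idx0 i)) => [->|q0]; first by rewrite (negbTE p0).
by case: (eqVneq q (idx1 i)) => [->|q1] //; rewrite (negbTE p1).
Qed.

(** Both factors only mix the rows and the columns [i] and [i+1], and below the
    diagonal the only entry that this can make nonzero is [(i+1, i)]: being upper
    triangular with positive diagonal is a condition on one 2x2 block. *)
Lemma Upplus_plane_mx i a b c d a' b' c' d' U : Upplus U ->
  let x := U (idx0 i) (idx0 i) in let y := U (idx0 i) (idx1 i) in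
  let w := U (idx1 i) (idx1 i) in
  c * x * a' + (c * y + d * w) * c' = 0 ->
  0 < a * x * a' + (a * y + b * w) * c' ->
  0 < c * x * b' + (c * y + d * w) * d' ->
  Upplus (plane_mx i a b c d *m U *m plane_mx i a' b' c' d').
Proof.
move=> [U0 Ud] /= W10 W00 W11.
have U10 : U (idx1 i) (idx0 i) = 0 by rewrite U0.
have i01 := idx_neq i; have i10 : (idx1 i == idx0 i) = false by rewrite eq_sym.
split=> [p q qp|p].
  rewrite mul_plane_mxE !plane_mx_mulE.
  case: (eqVneq q (idx0 i)) qp => [->|q0] qp.
    case: (eqVneq p (idx0 i)) qp => [->|p0] qp; first by rewrite ltnn in qp.
    case: (eqVneq p (idx1 i)) qp => [->|p1] qp; first by rewrite U10 mulr0 addr0.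
    by rewrite !U0 ?mul0r ?addr0//; move: p0 p1 qp; rewrite -!val_eqE /= /bump /= add1n; lia.
  case: (eqVneq q (idx1 i)) qp => [->|q1] qp.
    have p0 : (p == idx0 i) = false.
      by apply/negbTE; move: qp; rewrite -!val_eqE /= /bump /= add1n; lia.
    have p1 : (p == idx1 i) = false.
      by apply/negbTE; move: qp; rewrite -!val_eqE /= /bump /= add1n; lia.
    by rewrite p0 p1 !U0 ?mul0r ?addr0//; move: qp; rewrite /= /bump /= add1n; lia.
  case: (eqVneq p (idx0 i)) qp => [->|p0] qp.
    by rewrite !U0 ?mulr0 ?addr0//; move: qp; rewrite /= /bump /= add1n; lia.
  case: (eqVneq p (idx1 i)) qp => [->|p1] qp; last exact: U0.
  by rewrite !U0 ?mulr0 ?addr0//; move: q0 q1 qp; rewrite -!val_eqE /= /bump /= add1n; lia.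
rewrite mul_plane_mxE !plane_mx_mulE.
case: (eqVneq p (idx0 i)) => [_|p0]; first by rewrite ?eqxx U10 mulr0 addr0.
case: (eqVneq p (idx1 i)) => [_|p1] //.
by rewrite ?i10 ?eqxx U10 mulr0 addr0.
Qed.

End Block.

(** * Rotations and Bruhat cells *)

Section Cells.
Context {R : realType} {n : nat}.
Implicit Types (i : 'I_n) (U A B P : 'M[R]_n.+1) (s : {perm 'I_n.+1}).

Definition plane_rot i (t : R) : 'M[R]_n.+1 := plane_mx i (cos t) (- sin t) (sin t) (cos t).

Lemma plane_rotD i (u t : R) : plane_rot i (u + t) = plane_rot i u *m plane_rot i t.
Proof. by rewrite /plane_rot plane_mx_mul cosD sinD; congr plane_mx; ring. Qed.

Lemma plane_rot0 i : plane_rot i 0 = 1%:M.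
Proof. by rewrite /plane_rot cos0 sin0 oppr0 plane_mx1. Qed.

Lemma plane_rotNK i t : plane_rot i t *m plane_rot i (- t) = 1%:M.
Proof. by rewrite -plane_rotD subrr plane_rot0. Qed.

Lemma plane_rotKN i t : plane_rot i (- t) *m plane_rot i t = 1%:M.
Proof. by rewrite -plane_rotD addNr plane_rot0. Qed.

Lemma tr_plane_rot i t : (plane_rot i t)^T = plane_rot i (- t).
Proof. by rewrite /plane_rot tr_plane_mx cosN sinN opprK. Qed.

Lemma plane_rot_sign i (b : bool) t : plane_rot i ((-1) ^+ b * t) =
  plane_mx i (cos t) (- ((-1) ^+ b * sin t)) ((-1) ^+ b * sin t) (cos t).
Proof. by rewrite /plane_rot; case: b; rewrite ?expr1 ?expr0 ?mulN1r ?mul1r ?cosN ?sinN. Qed.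

Lemma plane_rot_quarter i (b : bool) : plane_rot i ((-1) ^+ b * (pi / 2)) =
  plane_mx i 0 (- (-1) ^+ b) ((-1) ^+ b) 0.
Proof. by rewrite plane_rot_sign cos_pihalf sin_pihalf mulr1. Qed.

Lemma sign_sq (b : bool) : (-1) ^+ b * (-1) ^+ b = 1 :> R.
Proof. by case: b; rewrite ?expr1 ?expr0; ring. Qed.

(** The arc cotangent with values between 0 and [pi] is [pi / 2 - atan]. *)
Lemma cos_arccot (x : R) : cos (pi / 2 - atan x) = x * sin (pi / 2 - atan x).
Proof.
rewrite cosB sinB cos_pihalf sin_pihalf !mul0r !mul1r add0r subr0.
have /andP[lo hi] : - (pi / 2) < atan x < pi / 2 by rewrite atan_gtNpi2 atan_ltpi2.
have c0 : cos (atan x) != 0 by rewrite gt_eqF// cos_gt0_pihalf// lo.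
by rewrite -{2}[x]atanK /tan divfK.
Qed.

Lemma arccot_itv (x : R) : 0 < pi / 2 - atan x < pi.
Proof. have := atan_ltpi2 x; have := atan_gtNpi2 x; lra. Qed.

Lemma sin_arccot_gt0 (x : R) : 0 < sin (pi / 2 - atan x).
Proof. by have /andP[? ?] := arccot_itv x; apply: sin_gt0_pi; apply/andP. Qed.

Lemma arccotP (t x : R) : 0 < t < pi -> cos t = x * sin t -> t = pi / 2 - atan x.
Proof.
move=> /andP[t0 tpi] ct.
have s0 : sin t != 0 by rewrite gt_eqF// sin_gt0_pi// t0.
suff -> : x = tan (pi / 2 - t) by rewrite tanK ?in_itv/=; lra.
by rewrite /tan cosB sinB cos_pihalf sin_pihalf !mul0r !mul1r add0r subr0 ct mulfK.
Qed.

(** For [A = U1 (P R_i(e pi/2)) U2] the angle is the one that makes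
    [R_i(e pi/2) U2 R_i(- e t)] upper triangular. *)
Lemma cell_unrot i (b : bool) P A :
  Bruhat_cell (P *m plane_rot i ((-1) ^+ b * (pi / 2))) A ->
  exists2 t, 0 < t < pi & Bruhat_cell P (A *m plane_rot i (- ((-1) ^+ b * t))).
Proof.
move=> [U1 [U2 [hU1 hU2 ->]]]; have [U0 Ud] := hU2.
set x := U2 (idx0 i) (idx0 i); set y := U2 (idx0 i) (idx1 i); set w := U2 (idx1 i) (idx1 i).
have [x0 w0] : 0 < x /\ 0 < w by split; exact: Ud.
pose e : R := (-1) ^+ b.
(* The entry (i+1, i) of the product is e x cos t - y sin t. *)
pose c := e * y / x; exists (pi / 2 - atan c); first exact: arccot_itv.
set t := pi / 2 - atan c.
have ct : cos t = c * sin t := cos_arccot c.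
have st : 0 < sin t := sin_arccot_gt0 c.
exists U1, (plane_rot i ((-1) ^+ b * (pi / 2)) *m U2 *m plane_rot i (- ((-1) ^+ b * t))).
split=> //; last by rewrite !mulmxA.
rewrite -mulrN plane_rot_quarter plane_rot_sign cosN sinN -/e.
have e2 : e * e = 1 := sign_sq b.
apply: Upplus_plane_mx => //; rewrite -/x -/y -/w.
- have -> : cos t = e * y / x * sin t by [].
  transitivity (y * sin t * (e * e - e * e)); last by rewrite subrr mulr0.
  by field; rewrite gt_eqF.
- rewrite (_ : _ + _ = (e * e) * (w * sin t)); last by ring.
  by rewrite e2 mul1r mulr_gt0.
- have -> : cos t = e * y / x * sin t by [].
  rewrite (_ : _ + _ = (e * e) * (x * sin t + y ^+ 2 * sin t / x)); last first.
    by field; rewrite gt_eqF.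
  rewrite e2 mul1r ltr_pwDl ?mulr_gt0//.
  by rewrite divr_ge0 ?(ltW x0)// mulr_ge0 ?sqr_ge0// ltW.
Qed.

Definition monomial_mx s (sg : 'I_n.+1 -> R) P :=
  forall p, sg p * sg p = 1 /\ forall q, P p q = sg p * (s p == q)%:R.

Lemma monomial_rot i (b : bool) s sg P : monomial_mx s sg P ->
  exists sg', monomial_mx (s * adj_transp i)%g sg' (P *m plane_rot i ((-1) ^+ b * (pi / 2))).
Proof.
move=> hP; pose e : R := (-1) ^+ b.
exists (fun p => if s p == idx0 i then - (e * sg p) else if s p == idx1 i then e * sg p else sg p).
move=> p; have [sg1 Pp] := hP p; have e2 : e * e = 1 := sign_sq b; split.
  case: ifP => _; last case: ifP => // _.
    by rewrite mulrNN mulrACA e2 sg1 mulr1.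
  by rewrite mulrACA e2 sg1 mulr1.
move=> q; rewrite plane_rot_quarter mul_plane_mxE !Pp permM /adj_transp -/e.
case: tpermP => [->|->|/eqP/negbTE p0 /eqP/negbTE p1].
- rewrite eqxx idx_neq [idx1 i == q]eq_sym [idx0 i == q]eq_sym.
  case: (eqVneq q (idx0 i)) => [->|q0]; first by rewrite idx_neq !mulr0 mul0r addr0.
  case: (eqVneq q (idx1 i)) => q1; first by ring.
  by rewrite !mulr0.
- rewrite eqxx [idx1 i == idx0 i]eq_sym idx_neq [idx0 i == q]eq_sym [idx1 i == q]eq_sym.
  case: (eqVneq q (idx0 i)) => [_|q0]; first by ring.
  case: (eqVneq q (idx1 i)) => q1; first by rewrite !mulr0 mul0r addr0.
  by rewrite !mulr0.
- rewrite p0 p1; case: (eqVneq q (idx0 i)) => [->|q0]; first by rewrite p0 !mulr0 !mul0r addr0.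
  by case: (eqVneq q (idx1 i)) => [->|q1] //; rewrite p1 !mulr0 !mul0r addr0.
Qed.

(** Bruhat decomposition in the plane: [U2 R_i(e t)] is
    [(1 + v E_(i,i+1)) R_i(e pi/2) V2] with [V2] upper triangular, and
    [P (1 + v E_(i,i+1)) = (1 + z E_(a,a')) P] where [a] and [a'] are the rows in
    which [P] has its entries of columns [i] and [i+1].  The hypothesis [a < a'] makes
    the new factor upper triangular. *)
Lemma cell_rot i (b : bool) s sg P B t : monomial_mx s sg P ->
  ((s^-1)%g (idx0 i) < (s^-1)%g (idx1 i))%N -> 0 < t < pi ->
  Bruhat_cell P B ->
  Bruhat_cell (P *m plane_rot i ((-1) ^+ b * (pi / 2))) (B *m plane_rot i ((-1) ^+ b * t)).
Proof.
move=> hP; set a := (s^-1)%g _; set a' := (s^-1)%g _ => aa' tpi [U1 [U2 [hU1 hU2 ->]]].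
have st : 0 < sin t by apply: sin_gt0_pi.
have [U0 Ud] := hU2.
set x := U2 (idx0 i) (idx0 i); set y := U2 (idx0 i) (idx1 i); set w := U2 (idx1 i) (idx1 i).
have [x0 w0] : 0 < x /\ 0 < w by split; exact: Ud.
have e2 := sign_sq b; pose e : R := (-1) ^+ b.
(* This v cancels the entry (i+1, i) of V2 below, whose left factor is
   R_i(- e pi/2) (1 - v E_(i,i+1)). *)
pose v := (y + e * x * cos t / sin t) / w.
have [sa sa'] : s a = idx0 i /\ s a' = idx1 i by rewrite /a /a' !permKV.
pose z := sg a * sg a' * v.
pose V1 := U1 *m (1%:M + z *: delta_mx a a').
pose V2 := plane_mx i 0 e (- e) (e * v) *m U2 *m plane_rot i ((-1) ^+ b * t).
exists V1, V2; split.
- have V1E p q : V1 p q = U1 p q + z * U1 p a *+ (q == a').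
    rewrite /V1 mulmxDr mulmx1 -scalemxAr !mxE; congr (_ + _).
    rewrite (bigD1 a) //= big1 ?addr0 => [|j ja]; rewrite mxE ?eqxx ?(negbTE ja) ?mulr0 //=.
    by case: (q == a'); rewrite ?mulr1 ?mulr1n ?mulr0 ?mulr0n.
  case: hU1 => U10 U1d; split=> [p q qp|p]; rewrite V1E.
    rewrite U10// add0r; case: eqP qp => // -> qp.
    by rewrite U10 ?mulr0 ?mul0rn//; exact: ltn_trans aa' qp.
  by case: eqP => [->|_]; rewrite ?mulr0n ?addr0// (U10 a' a)// mulr0 mul0rn addr0.
- rewrite /V2 plane_rot_sign -/e.
  apply: Upplus_plane_mx => //; rewrite -/x -/y -/w.
  + rewrite (_ : _ + _ = (e * e) * ((v * w - y) * sin t) - e * x * cos t); last by ring.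
    rewrite e2 mul1r /v divfK ?gt_eqF//.
    rewrite (_ : _ - y = e * x * cos t / sin t); last by ring.
    by rewrite divfK ?gt_eqF// subrr.
  + rewrite (_ : _ + _ = (e * e) * (w * sin t)); last by ring.
    by rewrite e2 mul1r mulr_gt0.
  + rewrite (_ : _ + _ = (e * e) * (x * sin t) + e * (v * w - y) * cos t); last by ring.
    rewrite e2 mul1r /v divfK ?gt_eqF//.
    rewrite (_ : e * _ * _ = (e * e) * (x * cos t ^+ 2 / sin t)); last first.
      by field; rewrite gt_eqF.
    rewrite e2 mul1r ltr_pwDl ?mulr_gt0//.
    by rewrite divr_ge0 ?(ltW st)// mulr_ge0 ?sqr_ge0// ltW.
- have comm : (1%:M + z *: delta_mx a a') *m P = P *m plane_mx i 1 v 0 1.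
    apply/matrixP => p q.
    have zE : z * sg a' = sg a * v.
      have [sg1 _] := hP a'.
      have -> : z * sg a' = sg a * v * (sg a' * sg a') by rewrite /z; ring.
      by rewrite sg1 mulr1.
    rewrite mulmxDl mul1mx -scalemxAl mul_plane_mxE [LHS]mxE [X in _ + X]mxE [X in _ * X]mxE.
    rewrite (bigD1 a') //= big1 ?addr0 => [|j ja]; last by rewrite mxE (negbTE ja) andbF mul0r.
    rewrite mxE eqxx andbT.
    have [_ Pp] := hP p; have [_ Pa'] := hP a'; rewrite !Pp Pa' sa'.
    case: (eqVneq p a) => [->|pa].
      rewrite sa eqxx idx_neq mul1r !mulr1 !mulr0 mulrA zE.
      rewrite ![_ == q]eq_sym; case: eqVneq => [->|q0]; first by rewrite idx_neq mulr1 mulr0.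
      by case: eqVneq => [_|q1]; rewrite !(mulr0, mulr1) ?add0r ?addr0.
    have spa : (s p == idx0 i) = false.
      by apply/negbTE; apply: contra pa; rewrite -sa => /eqP/perm_inj ->.
    rewrite spa !(mulr0, mul0r, addr0, add0r, mulr1).
    case: (eqVneq q (idx0 i)) => [->|q0]; first by rewrite spa mulr0.
    by case: (eqVneq q (idx1 i)) => [->|q1] //.
  rewrite /V1 -!mulmxA [(_ + _) *m (P *m _)]mulmxA comm -!mulmxA; congr (_ *m (_ *m _)).
  rewrite /V2 !mulmxA; congr (_ *m _).
  suff -> : plane_mx i 1 v 0 1 *m plane_rot i ((-1) ^+ b * (pi / 2)) *m plane_mx i 0 e (- e) (e * v) = 1%:M.
    by rewrite mul1mx.
  rewrite plane_rot_quarter -/e !plane_mx_mul -(plane_mx1 i); congr plane_mx.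
  + by transitivity (e * e); [ring|].
  + by ring.
  + by ring.
  + by transitivity (e * e); [ring|].
Qed.

End Cells.

(** * The angle as a function on the cell *)

Section CellCoordinate.
Context {R : realType} {n : nat}.
Implicit Types (i : 'I_n) (U A B P : 'M[R]_n.+1) (s : {perm 'I_n.+1}).

Lemma Upplus_det U : Upplus U -> \det U != 0.
Proof.
move=> [U0 Ud]; rewrite -det_tr det_trig; last first.
  by apply/is_trig_mxP => p q pq; rewrite mxE U0.
by apply/prodf_neq0 => p _; rewrite mxE gt_eqF.
Qed.

Lemma monomial_trK s sg P : monomial_mx s sg P -> P^T *m P = 1%:M.
Proof.
move=> hP; apply: mulmx1C; apply/matrixP => p q; rewrite !mxE.
rewrite (bigD1 (s p)) //= big1 ?addr0 => [|j jp].
  have [sg1 Pp] := hP p; have [_ Pq] := hP q.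
rewrite mxE Pp Pq eqxx mulr1 (inj_eq (@perm_inj _ s)).
  by rewrite eq_sym; case: eqVneq => [<-|_]; rewrite ?mulr1 ?mulr0.
by have [_ Pp] := hP p; rewrite mxE Pp eq_sym (negbTE jp) mulr0 mul0r.
Qed.

Lemma monomial_det s sg P : monomial_mx s sg P -> \det P != 0.
Proof.
move=> /monomial_trK /(congr1 determinant); rewrite det_mulmx det1.
by apply: contra_eq_neq => ->; rewrite mulr0 eq_sym oner_eq0.
Qed.

Lemma Upplus_inv U : Upplus U -> forall p q : 'I_n.+1, (q < p)%N -> invmx U p q = 0.
Proof.
move=> hU; have [U0 Ud] := hU.
have uU : U \in unitmx by rewrite unitmxE unitfE Upplus_det.
suff H d : forall p q : 'I_n.+1, (n.+1 - p <= d)%N -> (q < p)%N -> invmx U p q = 0.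
  by move=> p q; exact: (H n.+1 p q (leq_subr _ _)).
elim: d => [|d IH] p q; first by have := ltn_ord p; lia.
move=> pd qp; have := mulmxV uU => /matrixP/(_ p q); rewrite !mxE.
rewrite (bigD1 p) //= big1 => [|j jp].
  rewrite addr0 => /eqP; rewrite [p == q](_ : _ = false) ?mulf_eq0 ?(gt_eqF (Ud p))//=; first by move/eqP.
  by apply/negbTE; rewrite -val_eqE /= gtn_eqF.
case: (ltngtP j p) => [jp'|jp'|/val_inj jp']; last by rewrite jp' eqxx in jp.
  by rewrite U0 ?mul0r.
by rewrite (IH j) ?mulr0 //; [lia|exact: ltn_trans qp jp'].
Qed.

(** The rows in [L] vanish outside the columns in [K]; no permutation maps [L]
    into the smaller set [K], so each term of the Leibniz formula has a zero
    factor. *)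
Lemma det_zero_block A (L K : {set 'I_n.+1}) : (#|K| < #|L|)%N ->
  (forall l j, l \in L -> j \notin K -> A l j = 0) -> \det A = 0.
Proof.
move=> KL A0; rewrite /determinant big1 // => s _.
have [l lL slK] : exists2 l, l \in L & s l \notin K.
  apply/exists_inP; apply: contraLR KL => /exists_inPn sK; rewrite -leqNgt.
  rewrite -(card_imset (mem L) (@perm_inj _ s)); apply/subset_leq_card/fintype.subsetP => j.
  by move=> /imsetP[l lL ->]; have := sK l lL; rewrite negbK.
by rewrite (bigD1 l) //= A0 // mul0r mulr0.
Qed.

Section Coordinate.
Variables (i : 'I_n) (s : {perm 'I_n.+1}) (C : 'M[R]_n.+1).
Let r := ((s * adj_transp i)^-1)%g.
Let b := r (idx0 i).

(** [s] is the permutation of the smaller cell, [r] inverts that of the larger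
    one, and [C] is to be [U1 P1], where [P1] is the signed permutation matrix of
    the larger cell.  The columns [C_j] with [r j < b] span the same space as the
    first basis vectors; together with the columns [A_j] with [j < i] and [b < r j],
    they span a space that contains the column [i] of [A] if [A] is in the smaller
    cell.  The remaining columns of [C] only complete the matrix to a square one,
    so [frame_det A v] is a coordinate of [v] modulo this span. *)
Definition frame_mx A (v : 'I_n.+1 -> R) : 'M[R]_n.+1 := \matrix_(p, j)
  if j == idx0 i then v p
  else if (j < idx0 i)%N && (b < r j)%N then A p j else C p j.

Definition frame_det A (v : 'I_n.+1 -> R) := \det (frame_mx A v).

Lemma frame_detE A v :
  frame_det A v = \sum_p v p * cofactor (frame_mx A (fun=> 0)) p (idx0 i).
Proof.
rewrite /frame_det (expand_det_col _ (idx0 i)); apply: eq_bigr => p _.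
rewrite mxE eqxx; congr (_ * _); rewrite /cofactor; congr (_ * \det _).
apply/matrixP => x y; rewrite !mxE.
by rewrite eq_sym (negbTE (neq_lift _ _)).
Qed.

Lemma frame_det_lin A (a c : R) u v :
  frame_det A (fun p => a * u p + c * v p) = a * frame_det A u + c * frame_det A v.
Proof.
rewrite !frame_detE !mulr_sumr -big_split; apply: eq_bigr => p _ /=; ring.
Qed.

Lemma frame_mx_ext A A' v : (forall p (j : 'I_n.+1), (j < idx0 i)%N -> A p j = A' p j) ->
  frame_mx A v = frame_mx A' v.
Proof. by move=> AA; apply/matrixP => p j; rewrite !mxE; case: ifP => // _; case: ifP => // /andP[/AA]. Qed.

End Coordinate.

Section Coordinate2.
Variables (i : 'I_n) (s : {perm 'I_n.+1}) (sg sg1 : 'I_n.+1 -> R) (P P1 U1 : 'M[R]_n.+1).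
Hypothesis hP : monomial_mx s sg P.
Hypothesis hP1 : monomial_mx (s * adj_transp i)%g sg1 P1.
Hypothesis hs : ((s^-1)%g (idx0 i) < (s^-1)%g (idx1 i))%N.
Hypothesis hU1 : Upplus U1.
Let r := ((s * adj_transp i)^-1)%g.
Let D := frame_det i s (U1 *m P1).

Let rE j : r j = (s^-1)%g (adj_transp i j).
Proof. by apply: (canLR (permK _)); rewrite permM permKV /adj_transp tpermK. Qed.

(** Multiplying the frame on the left by [P^T V1^-1], where [B = V1 P V2], turns it
    into a matrix with a zero block too large for it to be invertible. *)
Lemma frame_det_small B : Bruhat_cell P B -> D B (fun p => B p (idx0 i)) = 0.
Proof.
move=> [V1 [V2 [hV1 [V20 V2d] BE]]].
have uV1 : V1 \in unitmx by rewrite unitmxE unitfE Upplus_det.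
have rb : r (idx0 i) = (s^-1)%g (idx1 i) by rewrite rE tpermL.
have ra : r (idx1 i) = (s^-1)%g (idx0 i) by rewrite rE tpermR.
set X := frame_mx i s (U1 *m P1) B (fun p => B p (idx0 i)).
pose T := P^T *m invmx V1.
have dT : \det T != 0.
  rewrite det_mulmx mulf_neq0//; last by rewrite det_inv invr_eq0 Upplus_det.
  by rewrite det_tr (monomial_det hP).
suff : \det (T *m X) = 0 by move/eqP; rewrite det_mulmx mulf_eq0 (negbTE dT) => /eqP.
have TB : T *m B = V2.
  by rewrite BE !mulmxA /T -(mulmxA P^T) mulVmx// mulmx1 (monomial_trK hP) mul1mx.
have TXB l j : (forall p, X p j = B p j) -> (T *m X) l j = V2 l j.
  by move=> XB; rewrite -TB !mxE; apply: eq_bigr => p _; rewrite XB.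
have TXC l j : (forall p, X p j = (U1 *m P1) p j) -> (r j < (s^-1)%g l)%N -> (T *m X) l j = 0.
  move=> XC rjl.
  transitivity ((T *m (U1 *m P1)) l j); first by rewrite !mxE; apply: eq_bigr => p _; rewrite XC.
  have Tlp (p : 'I_n.+1) : (p <= r j)%N -> T l p = 0.
    move=> pr; rewrite mxE (bigD1 ((s^-1)%g l)) //= big1 ?addr0 => [|q ql].
      by rewrite Upplus_inv ?mulr0//; exact: leq_ltn_trans pr rjl.
    rewrite mxE (hP q).2 [s q == l](_ : _ = false) ?mulr0 ?mul0r//.
    by apply/negbTE; apply: contra ql => /eqP <-; rewrite permK.
  rewrite mxE big1 // => p _.
  case: (leqP p (r j)) => pr; first by rewrite Tlp// mul0r.
  rewrite [X in _ * X]mxE big1 ?mulr0 // => q _; rewrite (hP1 q).2.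
  case: eqVneq => [qj|_]; last by rewrite !mulr0.
  have [U10 _] := hU1; rewrite U10 ?mul0r//.
  by rewrite (_ : q = r j)// /r -qj permK.
pose L : {set 'I_n.+1} := finset.finset (fun l => ((s^-1)%g (idx1 i) <= (s^-1)%g l)%N && (idx0 i < l)%N).
pose K : {set 'I_n.+1} := finset.finset (fun j => (r (idx0 i) < r j)%N && (idx0 i < j)%N).
apply: (@det_zero_block _ L K).
  apply: proper_card; apply/properP; split.
    apply/fintype.subsetP => j; rewrite !finset.in_set rb => /andP[rj ij]; rewrite ij andbT.
    case: (eqVneq j (idx1 i)) => [-> //|j1].
    suff -> : (s^-1)%g j = r j by exact: ltnW.
    rewrite rE /adj_transp tpermD// eq_sym// -val_eqE /=.
    by apply/negbT; rewrite gtn_eqF.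
  exists (idx1 i); rewrite finset.in_set ?leqnn ?rb ?ra //.
  by rewrite ltnNge (ltnW hs).
move=> l j; rewrite !finset.in_set => /andP[bl il] jK.
case: (eqVneq j (idx0 i)) => [->|j0].
  by rewrite TXB ?V20// => p; rewrite mxE eqxx.
case J : ((j < idx0 i)%N && (r (idx0 i) < r j)%N).
  rewrite TXB ?V20//; first by case/andP: J => ji _; exact: ltn_trans ji il.
  by move=> p; rewrite mxE (negbTE j0) J.
apply: TXC => [p|]; first by rewrite mxE (negbTE j0) J.
apply: leq_trans bl; rewrite -rb ltn_neqAle; apply/andP; split.
  by apply: contra j0 => /eqP/val_inj/perm_inj ->.
have /orP[ji|ji] : (j < idx0 i)%N || (idx0 i < j)%N by rewrite -neq_ltn.
  by move: J; rewrite ji /= => /negbT; rewrite -leqNgt.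
by move: jK; rewrite ji andbT -leqNgt.
Qed.

(** The columns [i] and [i+1] of [A] are [cos t B_i + e sin t B_(i+1)] and
    [- e sin t B_i + cos t B_(i+1)], and [B_i] contributes zero.  The frames of [A]
    and [B] agree, since they only use columns of index less than [i]. *)
Lemma frame_det_rot (eb : bool) t B (e := (-1) ^+ eb : R) (A := B *m plane_rot i (e * t)) :
  Bruhat_cell P B ->
  D A (fun p => A p (idx1 i)) * (e * sin t) = D A (fun p => A p (idx0 i)) * cos t.
Proof.
move=> hB; have B0 := frame_det_small hB.
have AE0 p : A p (idx0 i) = cos t * B p (idx0 i) + (e * sin t) * B p (idx1 i).
  by rewrite /A plane_rot_sign mul_plane_mxE eqxx -/e; ring.
have AE1 p : A p (idx1 i) = - (e * sin t) * B p (idx0 i) + cos t * B p (idx1 i).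
  by rewrite /A plane_rot_sign mul_plane_mxE eq_sym idx_neq eqxx -/e; ring.
have DAB v : D A v = D B v.
  rewrite /D /frame_det; congr (\det _); apply: frame_mx_ext => p j ji.
  rewrite /A plane_rot_sign mul_plane_mxE; case: eqP => [j0|_]; first by rewrite j0 ltnn in ji.
  by case: eqP => // j1; move: ji; rewrite j1 /= /bump /= add1n; lia.
rewrite (funext AE0) (funext AE1) !DAB /D !frame_det_lin -/D B0.
ring.
Qed.

(** At the point [U1 P1 U2] itself, the frame is [U1 P1] times an upper triangular
    matrix whose columns come from [U2] or from the identity. *)
Lemma frame_det_neq0 A U2 : Upplus U2 -> A = U1 *m P1 *m U2 ->
  D A (fun p => A p (idx0 i)) != 0.
Proof.
move=> [U20 U2d] AE.
pose U' : 'M[R]_n.+1 := \matrix_(l, j)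
  if (j == idx0 i) || (j < idx0 i)%N && (r (idx0 i) < r j)%N then U2 l j else (l == j)%:R.
suff -> : D A (fun p => A p (idx0 i)) = \det (U1 *m P1 *m U').
  rewrite !det_mulmx mulf_neq0// ?mulf_neq0 ?(Upplus_det hU1) ?(monomial_det hP1)//.
  apply: Upplus_det.
  split=> [p q qp|p]; rewrite mxE; case: ifP => _ //; first exact: U20.
    by rewrite -val_eqE /= gtn_eqF.
  by rewrite eqxx.
rewrite /D /frame_det; congr (\det _); apply/matrixP => p j.
rewrite [LHS]mxE AE [RHS]mxE.
case: ifP => [/eqP ->|j0].
  by rewrite mxE; apply: eq_bigr => q _; rewrite [U' _ _]mxE eqxx.
case: ifP => J.
  by rewrite mxE; apply: eq_bigr => q _; rewrite [U' _ _]mxE j0 J.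
rewrite (bigD1 j) //= big1 => [|q qj].
  by rewrite [U' _ _]mxE j0 J eqxx mulr1 addr0.
by rewrite [U' _ _]mxE j0 J (negbTE qj) mulr0.
Qed.

End Coordinate2.
End CellCoordinate.

(** * Products of rotations *)

Section RotationProducts.
Context {R : realType} {n : nat}.
Implicit Types (i : 'I_n) (A B P Q : 'M[R]_n.+1) (s : {perm 'I_n.+1}).

Lemma open_preimage_on (S T : topologicalType) (U : set S) (O : set T) (f : S -> T) :
  open U -> (forall x, U x -> {for x, continuous f}) -> open O -> open (U `&` f @^-1` O).
Proof.
move=> oU cf oO; rewrite openE => x [Ux Ofx]; rewrite /interior; apply: filterI.
  exact: open_nbhs_nbhs.
by apply: (cf x Ux); exact: open_nbhs_nbhs.
Qed.

Lemma Ck_on_rot (V : normedModType R) k (U : set V) i (f : V -> R) : open U ->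
  Ck_on k U f -> forall p q, Ck_on k U (fun x => plane_rot i (f x) p q).
Proof.
move=> oU fk p q.
have [ck sk] := @Ck_on_cos_sin R k.
have cfk : Ck_on k U (fun x => cos (f x)) by exact: Ck_on_comp fk ck.
have sfk : Ck_on k U (fun x => sin (f x)) by exact: Ck_on_comp fk sk.
have nk : Ck_on k U (fun x => - sin (f x)).
  have := Ck_onM oU (@Ck_on_cst R V R k U (-1) oU) sfk.
  by apply: Ck_on_eq => // x _; rewrite mulN1r.
suff H b1 b2 b3 b4 b5 : Ck_on k U (fun x =>
    if b1 : bool then if b2 : bool then cos (f x) else if b3 : bool then - sin (f x) else 0
    else if b4 : bool then if b2 then sin (f x) else if b3 then cos (f x) else 0
    else (b5 : bool)%:R).
  by apply: (Ck_on_eq oU _ (H _ _ _ _ _)) => x _; rewrite [RHS]mxE.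
by case: b1 b2 b3 b4 b5 => [] [] [] [] [] //; exact: Ck_on_cst.
Qed.

Lemma Ck_on_mulmx (V : normedModType R) k (U : set V) (f g : V -> 'M[R]_n.+1) : open U ->
  (forall p q, Ck_on k U (fun x => f x p q)) -> (forall p q, Ck_on k U (fun x => g x p q)) ->
  forall p q, Ck_on k U (fun x => (f x *m g x) p q).
Proof.
move=> oU fk gk p q.
apply: (@Ck_on_eq _ _ _ _ _ (fun x => \sum_j f x p j * g x j q)) => //.
  by move=> x _; rewrite mxE.
by apply: Ck_on_sum => // j; exact: Ck_onM.
Qed.

(** The quotient of determinants of the frame attached to [A0] computes [cot t] for
    all points of the cell where its denominator is not zero. *)
Lemma cell_angle_smooth i (eb : bool) s sg P A0 (e := (-1) ^+ eb : R) :
  monomial_mx s sg P -> ((s^-1)%g (idx0 i) < (s^-1)%g (idx1 i))%N ->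
  Bruhat_cell (P *m plane_rot i (e * (pi / 2))) A0 ->
  exists (O : set 'M[R]_n.+1) (tau : 'M[R]_n.+1 -> R), [/\ open O, O A0, smooth_on O tau &
    forall B (t : R), Bruhat_cell P B -> 0 < t < pi -> O (B *m plane_rot i (e * t)) ->
      tau (B *m plane_rot i (e * t)) = t].
Proof.
move=> hP hs [U1 [U2 [hU1 hU2 A0E]]].
have [sg1 hP1] := monomial_rot i eb hP.
pose C := U1 *m (P *m plane_rot i (e * (pi / 2))).
pose F j A := frame_det i s C A (fun p => A p j).
have oT := @openT 'M[R]_n.+1.
have Fk j k : Ck_on k setT (F j).
  apply: Ck_on_det => // p q.
  pose r := ((s * adj_transp i)^-1)%g.
  have [b1|b1] := boolP (q == idx0 i).
    by apply: (Ck_on_eq oT _ (Ck_on_coord k p j oT)) => A _; rewrite [RHS]mxE b1.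
  have [b2|b2] := boolP ((q < idx0 i)%N && (r (idx0 i) < r q)%N).
    by apply: (Ck_on_eq oT _ (Ck_on_coord k p q oT)) => A _; rewrite [RHS]mxE (negbTE b1) b2.
  by apply: (Ck_on_eq oT _ (Ck_on_cst k (C p q) oT)) => A _; rewrite [RHS]mxE (negbTE b1) (negbTE b2).
pose O := setT `&` (F (idx0 i)) @^-1` [set x : R | x != 0].
have oO : open O.
  apply: open_preimage_on => //; first exact: (Fk (idx0 i) 0%N).
have FkO j k : Ck_on k O (F j) by apply: Ck_on_sub (Fk j k).
exists O, (fun A => pi / 2 + (-1) * atan (e * (F (idx1 i) A * (F (idx0 i) A)^-1))).
split=> //.
- by split=> //=; exact: (frame_det_neq0 hP1 hU1 hU2).
- move=> k; apply: Ck_onD => //; first exact: Ck_on_cst.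
  apply: Ck_onM => //; first exact: Ck_on_cst.
  apply: (@Ck_on_comp _ _ _ _ setT _ atan) => //; last exact: Ck_on_atan.
  apply: Ck_onM => //; first exact: Ck_on_cst.
  apply: Ck_onM => //.
  apply: (@Ck_on_comp _ _ _ _ _ _ GRing.inv) (Ck_on_inv k) => //.
  by move=> A [].
- move=> B t hB tpi [_ /= F0]; rewrite mulN1r; apply/esym/arccotP => //.
  have := frame_det_rot hP hP1 hs hU1 eb t hB; rewrite -/e -/C.
  rewrite -/(F (idx0 i) _) -/(F (idx1 i) _) => E.
  apply: (mulfI F0); rewrite -E; field; exact: F0.
Qed.

Definition rot_prod k (w : 'I_k -> 'I_n) (eb : 'I_k -> bool) Q (th : 'I_k -> R) : 'M[R]_n.+1 :=
  Q *m \prod_(j < k) plane_rot (w j) ((-1) ^+ eb j * th j).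

Section Step.
Variables (k : nat) (w : 'I_k.+1 -> 'I_n) (eb : 'I_k.+1 -> bool).
Let wd := widen_ord (leqnSn k).

Lemma rot_prodS Q th : rot_prod w eb Q th =
  rot_prod (w \o wd) (eb \o wd) Q (th \o wd)
    *m plane_rot (w ord_max) ((-1) ^+ eb ord_max * th ord_max).
Proof. by rewrite /rot_prod big_ord_recr /= -mulmxA. Qed.

End Step.

Lemma rot_prod_monomial k (w : 'I_k -> 'I_n) eb Q sg : monomial_mx 1%g sg Q ->
  exists sg', monomial_mx (\prod_(j < k) adj_transp (w j))%g sg'
    (rot_prod w eb Q (fun=> pi / 2)).
Proof.
move=> hQ; elim: k w eb => [|k IH] w eb; first by exists sg; rewrite /rot_prod !big_ord0 mulmx1.
have [sg1 h1] := IH (w \o widen_ord (leqnSn k)) (eb \o widen_ord (leqnSn k)).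
rewrite big_ord_recr rot_prodS; exact: monomial_rot h1.
Qed.

Lemma rot_prod_cell k (w : 'I_k -> 'I_n) eb Q sg th : monomial_mx 1%g sg Q ->
  reduced_word w -> (forall j, 0 < th j < pi) ->
  Bruhat_cell (rot_prod w eb Q (fun=> pi / 2)) (rot_prod w eb Q th).
Proof.
move=> hQ; elim: k w eb th => [|k IH] w eb th hw hth.
  rewrite /rot_prod !big_ord0; exists 1%:M, 1%:M.
  have Up1 : Upplus (1%:M : 'M[R]_n.+1).
    by split=> [p q qp|p]; rewrite mxE ?eqxx// -val_eqE /= gtn_eqF.
  by split=> //; rewrite mul1mx mulmx1.
have [hw' hs] := reduced_wordS hw.
have [sg' hP] := rot_prod_monomial (w \o widen_ord (leqnSn k)) (eb \o widen_ord (leqnSn k)) hQ.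
rewrite !rot_prodS; apply: (cell_rot _ hP hs) => //.
by apply: IH => // j; exact: hth.
Qed.

(** An upper triangular orthogonal matrix is diagonal: clear the rows from the last
    one upwards.  Its diagonal entries have the signs of [Q] and square 1. *)
Lemma cell_diag_orthogonal Q sg A : monomial_mx 1%g sg Q ->
  A *m A^T = 1%:M -> Bruhat_cell Q A -> A = Q.
Proof.
move=> hQ oA [U1 [U2 [[U10 U1d] [U20 U2d] AE]]].
have AE' p q : A p q = \sum_r U1 p r * sg r * U2 r q.
  rewrite AE mxE; apply: eq_bigr => r _; rewrite mxE (bigD1 r) //= big1 ?addr0 => [|x xr].
    by have [_ ->] := hQ r; rewrite perm1 eqxx mulr1.
  by have [_ ->] := hQ x; rewrite perm1 (negbTE xr) !mulr0.
have A0 (p q : 'I_n.+1) : (q < p)%N -> A p q = 0.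
  move=> qp; rewrite AE' big1 // => r _; case: (ltnP r p) => rp.
    by rewrite U10// !mul0r.
  by rewrite U20 ?mulr0//; exact: leq_trans qp rp.
have Ad p : A p p = (U1 p p * U2 p p) * sg p.
  rewrite AE' (bigD1 p) //= big1 ?addr0 => [|r rp]; first by rewrite mulrAC.
  case: (ltngtP r p) => [rp'|rp'|/val_inj rp']; last by rewrite rp' eqxx in rp.
    by rewrite U10// !mul0r.
  by rewrite U20 ?mulr0.
have Ad0 p : A p p != 0.
  have sg0 : sg p != 0.
    have [sg1 _] := hQ p; move: sg1; apply: contra_eq_neq => ->.
    by rewrite mul0r eq_sym oner_eq0.
  by rewrite Ad mulf_neq0// gt_eqF// mulr_gt0.
suff H d : forall p q : 'I_n.+1, (n.+1 - p <= d)%N -> q != p -> A p q = 0.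
  apply/matrixP => p q; have [sg1 ->] := hQ p; rewrite perm1.
  case: (eqVneq p q) => [<-|pq]; last by rewrite mulr0 (H n.+1) ?leq_subr// eq_sym.
  have := oA => /matrixP/(_ p p); rewrite !mxE eqxx (bigD1 p) //= big1 => [|r rp]; last first.
    by rewrite (H n.+1) ?leq_subr ?mul0r.
  rewrite mxE addr0 Ad mulr1; set u := U1 p p * U2 p p => uu.
  have u0 : 0 < u by rewrite mulr_gt0.
  have u1 : u * u = 1 by move: uu; rewrite mulrACA sg1 mulr1.
  suff -> : u = 1 by rewrite mul1r.
  by apply/eqP; rewrite -(@eqrXn2 _ 2%N)// ?ltW// expr1n expr2 u1.
elim: d => [|d IH] p q; first by have := ltn_ord p; lia.
move=> pd qp; case: (ltngtP q p) => [qp'|qp'|/val_inj qp']; first exact: A0.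
  have := oA => /matrixP/(_ p q); rewrite !mxE eq_sym (negbTE qp) (bigD1 q) //= big1 => [|r rq].
    by rewrite mxE addr0 => /eqP; rewrite mulf_eq0 (negbTE (Ad0 q)) orbF => /eqP.
  by rewrite mxE (IH q r) ?mulr0//; lia.
by rewrite qp' eqxx in qp.
Qed.

(** Undoing the rotations from the last one, which keeps the matrix orthogonal,
    leads to the cell of [Q]. *)
Lemma rot_prod_surj k (w : 'I_k -> 'I_n) eb Q sg A : monomial_mx 1%g sg Q ->
  A *m A^T = 1%:M -> Bruhat_cell (rot_prod w eb Q (fun=> pi / 2)) A ->
  exists2 th : 'I_k -> R, (forall j, 0 < th j < pi) & A = rot_prod w eb Q th.
Proof.
move=> hQ; elim: k w eb A => [|k IH] w eb A oA hA.
  exists (fun=> 0) => [[]//|]; move: hA; rewrite /rot_prod !big_ord0 !mulmx1.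
  exact: cell_diag_orthogonal.
move: hA; rewrite rot_prodS => /cell_unrot[t tpi hB].
have [|th thpi BE] := IH _ _ _ _ hB.
  by rewrite trmx_mul tr_plane_rot opprK mulmxA -(mulmxA A) plane_rotKN mulmx1.
exists (fun j => if unlift ord_max j is Some j' then th j' else t).
  by move=> j; case: unliftP => [j' _|_].
rewrite rot_prodS unlift_none.
have -> : (fun j => if unlift ord_max j is Some j' then th j' else t) \o widen_ord (leqnSn k) = th.
  apply/funext => j /=.
  have -> : widen_ord (leqnSn k) j = lift ord_max j by apply/val_inj; exact: esym (lift_max j).
  by rewrite liftK.
by rewrite -BE -mulmxA plane_rotKN mulmx1.
Qed.

(** The last angle is a smooth function [tau] of [A] near [A0]; the others are those
    of [A R_i(- e tau(A))], which lies near a point of the smaller cell.  As the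
    same [h] inverts the product over all of [O], injectivity follows too. *)
Lemma rot_prod_local_inverse k (w : 'I_k -> 'I_n) eb Q sg A0 : monomial_mx 1%g sg Q ->
  reduced_word w -> Bruhat_cell (rot_prod w eb Q (fun=> pi / 2)) A0 ->
  exists (O : set 'M[R]_n.+1) (h : 'I_k -> 'M[R]_n.+1 -> R),
    [/\ open O, O A0, forall j, smooth_on O (h j) &
      forall th : 'I_k -> R, (forall j, 0 < th j < pi) -> O (rot_prod w eb Q th) ->
        forall j, h j (rot_prod w eb Q th) = th j].
Proof.
move=> hQ; elim: k w eb A0 => [|k IH] w eb A0 hw hA0.
  by exists setT, (fun _ _ => 0); split=> // [|[]//|? ? ? []//]; exact: openT.
have [hw' hs] := reduced_wordS hw.
set wd := widen_ord (leqnSn k) in hw' hs *.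
have [sg' hP] := rot_prod_monomial (w \o wd) (eb \o wd) hQ.
rewrite rot_prodS -/wd in hA0.
have [t0 t0pi hB0] := cell_unrot hA0.
have [W1 [tau [oW1 WA0 tau_s tauE]]] := cell_angle_smooth hP hs hA0.
have [W2 [h [oW2 WB0 h_s hE]]] := IH _ _ _ hw' hB0.
set i := w ord_max in hs hA0 hB0 WB0 tauE *.
pose e : R := (-1) ^+ eb ord_max.
pose Bm A := A *m plane_rot i (- (e * tau A)).
have Bmk m p q : Ck_on m W1 (fun A => Bm A p q).
  apply: Ck_on_mulmx => //; first by move=> x y; exact: Ck_on_coord.
  apply: Ck_on_rot => //.
  have := Ck_onM oW1 (@Ck_on_cst R 'M[R]_n.+1 R m W1 (- e) oW1) (tau_s m).
  by apply: Ck_on_eq => // A _; rewrite mulNr.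
pose O := W1 `&` Bm @^-1` W2.
have oO : open O.
  apply: (open_preimage_on oW1) oW2.
  by have := Ck_on_mx oW1 (Bmk 0%N).
have A0E : A0 = (A0 *m plane_rot i (- (e * t0))) *m plane_rot i (e * t0) by rewrite -mulmxA plane_rotKN mulmx1.
exists O, (fun j => if unlift ord_max j is Some j' then fun A => h j' (Bm A) else tau); split=> //.
- split=> //=; rewrite /Bm.
  suff -> : tau A0 = t0 by [].
  by rewrite [in LHS]A0E tauE// -A0E.
- move=> j m; case: unliftP => [j' _|_]; last by apply: Ck_on_sub (tau_s m) => A [].
  apply: (@Ck_on_comp_mx _ _ _ _ _ _ W2 Bm) (h_s j' m) => //.
    by move=> A [].
  by move=> p q; apply: Ck_on_sub (Bmk m p q) => A [].
- move=> th thpi; rewrite rot_prodS -/wd -/i -/e.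
  set B := rot_prod _ _ _ _ => -[W1B W2B].
  have hB : Bruhat_cell (rot_prod (w \o wd) (eb \o wd) Q (fun=> pi / 2)) B.
    by apply: rot_prod_cell hQ hw' _ => j; exact: thpi.
  have tE : tau (B *m plane_rot i (e * th ord_max)) = th ord_max by exact: tauE.
  have BmE : Bm (B *m plane_rot i (e * th ord_max)) = B.
    by rewrite /Bm tE -mulmxA plane_rotNK mulmx1.
  move=> j; case: unliftP => [j' ->|->//].
  rewrite BmE /B (hE (th \o wd))//.
  - by congr th; apply/val_inj; exact: esym (lift_max j').
  - by move=> x; exact: thpi.
  - by move: W2B => /=; rewrite BmE.
Qed.

End RotationProducts.

(** * Lifting rotations to the covering group *)

(** The determinant is 1 or -1, and it is a square because [R_i(t)] is the square of
    [R_i(t/2)]. *)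
Lemma plane_rot_SO (R : realType) n (i : 'I_n) (t : R) : SO (plane_rot i t).
Proof.
have o (u : R) : plane_rot i u *m (plane_rot i u)^T = 1%:M by rewrite tr_plane_rot plane_rotNK.
split=> //; set d := \det _.
have d2 : d ^+ 2 = 1.
  by have := o t => /(congr1 determinant); rewrite det_mulmx det_tr det1 expr2.
have d0 : 0 <= d.
  rewrite /d (_ : t = t / 2 + t / 2); last by lra.
  by rewrite plane_rotD det_mulmx -expr2 sqr_ge0.
by apply/eqP; rewrite -(@eqrXn2 _ 2%N)// ?expr1n ?d2.
Qed.

Lemma plane_rot_continuous (R : realType) n (i : 'I_n) : continuous (@plane_rot R n i).
Proof.
have oT := @openT R; have idk : Ck_on 0 [set: R] (@id R) by move=> x _; exact: cvg_id.
by move=> t; apply: (Ck_on_mx oT (Ck_on_rot i oT idk)).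
Qed.

Lemma plane_rotMn (R : realType) n (i : 'I_n) (u : R) N :
  plane_rot i (N%:R * u) = plane_rot i u ^+ N :> 'M[R]_n.+1.
Proof.
elim: N => [|N IH]; first by rewrite mul0r plane_rot0 expr0.
by rewrite -natr1 mulrDl mul1r plane_rotD IH exprSr.
Qed.

Section ContinuousProducts.
Context {G : topGroupType}.

Lemma continuousMg (T : topologicalType) (f g : T -> G) (t : T) :
  {for t, continuous f} -> {for t, continuous g} ->
  {for t, continuous (fun y => (f y * g y)%g)}.
Proof.
move=> cf cg; apply: (@continuous_comp _ _ _ (fun y => (f y, g y)) (fun z : G * G => (z.1 * z.2)%g)).
  exact: cvg_pair.
exact: mulg_continuous.
Qed.

Lemma continuous_prodg (T : topologicalType) (I : Type) (r : seq I) (f : I -> T -> G) (t : T) :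
  (forall j, {for t, continuous (f j)}) ->
  {for t, continuous (fun y => (\prod_(j <- r) f j y)%g)}.
Proof.
move=> cf; elim: r => [|j r IH].
  rewrite (_ : (fun y => _) = fun=> 1%g); first exact: cst_continuous.
  by apply/funext => y; rewrite big_nil.
rewrite (_ : (fun y => _) = fun y => (f j y * \prod_(j <- r) f j y)%g).
  exact: continuousMg.
by apply/funext => y; rewrite big_cons.
Qed.

End ContinuousProducts.

Section Lifting.
Context {R : realType} {n : nat} {G : topGroupType} (Pi : G -> 'M[R]_n.+1).
Hypothesis hPi : universal_covering_hom Pi.
Implicit Types (i : 'I_n) (x y : G).

Lemma coverM x y : Pi (x * y)%g = Pi x *m Pi y.
Proof. by have [] := hPi. Qed.

Lemma cover_continuous : continuous Pi.
Proof. by have [_ []] := hPi. Qed.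

Lemma cover_SO x : SO (Pi x).
Proof. by have [_ [_ <- _] _] := hPi; exists x. Qed.

Lemma cover1 : Pi 1%g = 1%:M.
Proof.
have [orth _] := cover_SO 1%g.
by rewrite -[LHS]mulmx1 -orth mulmxA -coverM mulg1.
Qed.

Lemma cover_prod (I : Type) (r : seq I) (f : I -> G) :
  Pi (\prod_(j <- r) f j)%g = \prod_(j <- r) Pi (f j).
Proof.
by elim: r => [|j r IH]; rewrite ?big_nil ?cover1// !big_cons coverM IH.
Qed.

Lemma cover_exp x N : Pi (x ^+ N)%g = Pi x ^+ N.
Proof.
by elim: N => [|N IH]; rewrite ?cover1// expgS coverM IH exprS.
Qed.

(** From the sheet over a neighbourhood of the identity matrix that contains the
    identity of [G]. *)
Lemma local_section : exists (V : set G) (sct : 'M[R]_n.+1 -> G), [/\ open V, V 1%g,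
  forall x y, V x -> V y -> Pi x = Pi y -> x = y, sct 1%:M = 1%g &
  (\forall A \near (1%:M : 'M[R]_n.+1), SO A -> V (sct A) /\ Pi (sct A) = A)
  /\ sct A @[A --> within (@SO R n.+1) (nbhs (1%:M : 'M[R]_n.+1))] --> (1%g : G)].
Proof.
have S1 : SO (1%:M : 'M[R]_n.+1) by rewrite -cover1; exact: cover_SO.
have [_ [_ _ /(_ _ S1)[U [oU U1] [F [_ FU Fsh]]]] _] := hPi.
have : (\bigcup_(V in F) V) 1%g by rewrite FU /= cover1.
move=> [V FV V1]; have [oV [sct [csct sctP sctK]]] := Fsh V FV.
have sct1 : sct 1%:M = 1%g by rewrite -cover1 sctK.
exists V, sct; split=> //.
  by move=> x y Vx Vy xy; rewrite -(sctK x)// -(sctK y)// xy.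
have nU : nbhs (1%:M : 'M[R]_n.+1) U by exact: open_nbhs_nbhs.
split; first by apply: filterS nU => A UA SA; exact: sctP.
have C : sct @ within (U `&` @SO R n.+1) (nbhs (1%:M : 'M[R]_n.+1)) --> sct 1%:M.
  by have := (subspace_continuousP _ _).1 csct 1%:M (conj U1 S1).
move: C; rewrite sct1; apply: cvg_trans; apply: cvg_app => W /= W0.
by rewrite /within /=; apply: filterS2 nU W0 => A UA WA SA; exact: WA.
Qed.

(** Near 0, [g (s + t)] and [g s * g t] both lie in the sheet and have the same
    projection. *)
Lemma local_lift i : exists (V : set G) (d : R) (g : R -> G),
  [/\ open V, V 1%g, forall x y, V x -> V y -> Pi x = Pi y -> x = y, 0 < d &
  [/\ g 0 = 1%g, {for (0 : R), continuous g},
      forall t, `|t| < d -> Pi (g t) = plane_rot i t &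
      forall s t, `|s| < d -> `|t| < d -> `|s + t| < d -> g (s + t) = (g s * g t)%g]].
Proof.
have [V [sct [oV V1 Vinj sct1 [sctP csct]]]] := local_section.
pose g t := sct (plane_rot i t).
have g0 : g 0 = 1%g by rewrite /g plane_rot0.
have cr : plane_rot i t @[t --> (0 : R)] --> (1%:M : 'M[R]_n.+1).
  by rewrite -[X in _ --> X](plane_rot0 i); exact: plane_rot_continuous.
have cg : {for (0 : R), continuous g}.
  rewrite /prop_for /continuous_at g0; apply: cvg_comp csct => W /=.
  rewrite /within /= => W0; have W1 : \forall t \near (0 : R), SO (plane_rot i t : 'M[R]_n.+1) -> W (plane_rot i t) := cr _ W0.
  by apply: filterS W1 => t /= Wt; apply/Wt/plane_rot_SO.
have nP : \forall t \near (0 : R), V (g t) /\ Pi (g t) = plane_rot i t.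
  have W1 : \forall t \near (0 : R), SO (plane_rot i t : 'M[R]_n.+1) ->
    V (sct (plane_rot i t)) /\ Pi (sct (plane_rot i t)) = plane_rot i t := cr _ sctP.
  apply: filterS W1 => t /= Wt; exact/Wt/plane_rot_SO.
have nV : \forall z \near ((1%g, 1%g) : G * G), V (z.1 * z.2)%g.
  have := @mulg_continuous G (1%g, 1%g); apply.
  by rewrite /= mulg1; exact: open_nbhs_nbhs.
have [[N1 N2] /= [N1n N2n] NV] := nV.
have nN : \forall t \near (0 : R), N1 (g t) /\ N2 (g t).
  near=> t; split; near: t; apply: cg; by rewrite g0.
have [d d0 hd] : exists2 d, 0 < d & forall t : R, `|t| < d ->
    (V (g t) /\ Pi (g t) = plane_rot i t) /\ (N1 (g t) /\ N2 (g t)).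
  have : \forall t \near (0 : R), (V (g t) /\ Pi (g t) = plane_rot i t) /\ (N1 (g t) /\ N2 (g t)).
    exact: filterI nP nN.
  move=> /nbhs_ballP[d /= d0 hd]; exists d => // t td; apply: hd.
  by rewrite /ball /= sub0r normrN.
exists V, d, g; split=> //; split=> // [t /hd[[]]//|s t sd td std].
have [[_ Ps] [N1s _]] := hd _ sd; have [[_ Pt] [_ N2t]] := hd _ td.
have [[Vst Pst] _] := hd _ std.
apply: Vinj => //; first exact: (NV (g s, g t)).
by rewrite coverM Pst Ps Pt plane_rotD.
Unshelve. all: by end_near. Qed.

Definition is_rotation_lift i (gam : R -> G) :=
  [/\ continuous gam, forall s t, gam (s + t) = (gam s * gam t)%g &
      forall t, Pi (gam t) = plane_rot i t].

Lemma divN_lt (t d : R) : 0 < d -> exists N : nat, (0 < N)%N /\ `|t / N%:R| < d.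
Proof.
move=> d0; exists (Num.bound (`|t| / d)).+1; split=> //.
rewrite normrM normfV [`|_.+1%:R|]ger0_norm// ltr_pdivrMr// mulrC -ltr_pdivrMr//.
have td : 0 <= `|t| / d by rewrite divr_ge0// ltW.
by apply: (lt_trans (archi_boundP td)); rewrite ltr_nat.
Qed.

(** The local homomorphism [g] extends to all times by [gam t = g (t/N)^N] for any
    [N] large enough; comparing [N] and [M N] shows that the choice does not matter,
    and a common [N] for [s], [t] and [s + t] gives the homomorphism property. *)
Lemma rotation_lift_exists i : exists gam, is_rotation_lift i gam.
Proof.
have [V [d [g [oV V1 Vinj d0 [g0 cg Pg gD]]]]] := local_lift i.
have gX (u : R) (M j : nat) : (0 < M)%N -> `|u| < d -> (j <= M)%N ->
    g (j%:R * (u / M%:R)) = (g (u / M%:R)%R ^+ j)%g.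
  move=> M0 ud; have M0' : 0 < M%:R :> R by rewrite ltr0n.
  have small (k : nat) : (k <= M)%N -> `|k%:R * (u / M%:R)| < d.
    move=> kM; apply: le_lt_trans ud.
    rewrite mulrCA normrM ler_piMr// ger0_norm ?divr_ge0// ler_pdivrMr// mul1r ler_nat//.
  elim: j => [|j IH] jM; first by rewrite mul0r g0 expg0.
  rewrite -natr1 mulrDl mul1r gD ?expgSr ?IH ?small// ?(ltnW jM)//.
  - by have := small 1%N M0; rewrite mul1r.
  - by have := small j.+1 jM; rewrite -natr1 mulrDl mul1r.
have gN (t : R) (N M : nat) : (0 < N)%N -> (0 < M)%N -> `|t / N%:R| < d ->
    (g (t / N%:R)%R ^+ N)%g = (g (t / (M * N)%:R)%R ^+ (M * N))%g.
  move=> N0 M0 td; have M0' : M%:R != 0 :> R by rewrite pnatr_eq0 -lt0n.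
  have := gX _ M M M0 td (leqnn _); rewrite mulrCA divff// mulr1 => ->.
  by rewrite -expgnA natrM invfM [_^-1 * _]mulrC mulrA.
have cN t := divN_lt t d0.
pose nN (t : R) := projT1 (cid (cN t)).
have nNP t : (0 < nN t)%N /\ `|t / (nN t)%:R| < d by exact: (projT2 (cid (cN t))).
pose gam (t : R) := (g (t / (nN t)%:R)%R ^+ nN t)%g.
have gamE (t : R) (N : nat) : (0 < N)%N -> `|t / N%:R| < d -> gam t = (g (t / N%:R)%R ^+ N)%g.
  move=> N0 tN; have [n0 tn] := nNP t.
  by rewrite /gam (gN _ _ N)// (gN _ N (nN t))// mulnC.
have gamg (t : R) : `|t| < d -> gam t = g t.
  by move=> td; rewrite (gamE t 1%N)// ?expg1 divr1.
have small (t : R) (N M : nat) : (0 < N)%N -> (0 < M)%N -> `|t / N%:R| < d -> `|t / (M * N)%:R| < d.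
  move=> N0 M0; apply: le_lt_trans.
  rewrite natrM invfM mulrCA normrM ler_piMl// ger0_norm ?invr_ge0// invf_le1 ?ltr0n//.
  by rewrite ler1n.
have gamD s t : gam (s + t) = (gam s * gam t)%g.
  have [a0 sa] := nNP s; have [b0 tb] := nNP t; have [c0 stc] := nNP (s + t).
  set a := nN s in a0 sa; set b := nN t in b0 tb; set c := nN (s + t) in c0 stc.
  pose N := (a * b * c)%N.
  have N0 : (0 < N)%N by rewrite !muln_gt0 a0 b0.
  have sN : `|s / N%:R| < d by rewrite /N -mulnA mulnC small// muln_gt0 b0.
  have tN : `|t / N%:R| < d by rewrite /N mulnAC small// muln_gt0 a0.
  have stN : `|(s + t) / N%:R| < d by rewrite /N small// muln_gt0 a0.
  have stN' : `|s / N%:R + t / N%:R| < d by rewrite -mulrDl.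
  have comm : commute (g (s / N%:R)) (g (t / N%:R)).
    by rewrite /commute -!gD// addrC.
  by rewrite (gamE (s + t) N)// (gamE s N)// (gamE t N)// mulrDl gD// expgMn.
exists gam; apply: And3 => //.
- have gam0 : gam 0 = 1%g by rewrite gamg ?normr0.
  have c0 : {for (0 : R), continuous gam}.
    rewrite /prop_for /continuous_at gam0 -g0; apply: cvg_trans cg; apply: near_eq_cvg.
    by near=> t; rewrite gamg//; near: t; exact: nbhs0_lt.
  move=> t0.
  have gE : (fun t => gam t0 * gam (t - t0)%R)%g = gam.
    by apply/funext => t; rewrite -gamD addrC subrK.
  suff H : {for t0, continuous (fun t => gam t0 * gam (t - t0)%R)%g} by rewrite gE in H.
  apply: continuousMg; first exact: cst_continuous.
  apply: (@continuous_comp _ _ _ (fun t => t - t0) gam); last by rewrite subrr.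
  by apply: continuousB; [exact: cvg_id|exact: cst_continuous].
- move=> t; rewrite /gam; have [n0 tn] := nNP t.
  by rewrite cover_exp Pg// -plane_rotMn mulrCA divff ?mulr1// pnatr_eq0 -lt0n.
Unshelve. all: by end_near. Qed.


Lemma is_derive_mx (V : normedModType R) m p (M : V -> 'M[R]_(m, p)) (t v : V) X :
  is_derive t v M X <-> forall a b, is_derive t v (fun u => M u a b) (X a b).
Proof.
split=> [[dM <-] a b|dM].
  apply: DeriveDef; first exact: (derivable_mxP _ _ _).1 dM a b.
  by rewrite derive_mx// mxE.
have dM' : derivable M t v by apply/derivable_mxP => a b; have [] := dM a b.
apply: DeriveDef => //; rewrite derive_mx//; apply/matrixP => a b; rewrite mxE.
by have [_ ->] := dM a b.
Qed.

Lemma mul_so_gen i (t : R) (M : 'M[R]_n.+1) p q : (M *m (t *: so_gen i)) p q =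
  if q == idx0 i then t * M p (idx1 i) else if q == idx1 i then - (t * M p (idx0 i)) else 0.
Proof.
rewrite -scalemxAr mulmxBr !mxE.
have D (a b : 'I_n.+1) : (\sum_j M p j * delta_mx a b j q) = M p a * (q == b)%:R.
  rewrite (bigD1 a) //= big1 ?addr0 => [|j ja]; first by rewrite mxE eqxx.
  by rewrite mxE (negbTE ja) mulr0.
rewrite !D; case: eqVneq => [->|_]; first by rewrite idx_neq mulr1 mulr0 subr0.
by case: eqVneq => _ /=; ring.
Qed.

Lemma is_derive_mull (t u : R) : is_derive u 1 (fun v : R => t * v) t.
Proof.
have D := @is_deriveZ R _ _ id t u 1 1 (is_derive_id u 1).
by apply: (is_derive_eq D); rewrite [_ *: _]mulr1.
Qed.

Lemma is_derive_cos_mull (t u : R) :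
  is_derive u 1 (fun v : R => cos (t * v)) (- (t * sin (t * u))).
Proof.
have D := @is_derive1_comp R cos (fun v => t * v) u _ _ (is_derive_cos _) (is_derive_mull t u).
by apply: (is_derive_eq D); rewrite mulNr mulrC.
Qed.

Lemma is_derive_sin_mull (t u : R) :
  is_derive u 1 (fun v : R => sin (t * v)) (t * cos (t * u)).
Proof.
have D := @is_derive1_comp R sin (fun v => t * v) u _ _ (is_derive_sin _) (is_derive_mull t u).
by apply: (is_derive_eq D); rewrite mulrC.
Qed.

Lemma plane_rot_derive0 i (t : R) :
  is_derive (0 : R) 1 (fun u => plane_rot i (t * u) : 'M[R]_n.+1) (t *: so_gen i).
Proof.
apply/is_derive_mx => p q.
have -> : (t *: so_gen i) p q = (1%:M *m (t *: so_gen i)) p q :> R by rewrite mul1mx.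
rewrite mul_so_gen !mxE.
have dc := is_derive_cos_mull t 0; have ds := is_derive_sin_mull t 0.
rewrite mulr0 sin0 mulr0 oppr0 in dc; rewrite mulr0 cos0 mulr1 in ds.
have dn := is_deriveN ds.
have d0 (c : R) : is_derive (0 : R) 1 (fun _ : R => c) 0 by exact: is_derive_cst.
have -> : (fun u => plane_rot i (t * u) p q) = fun u =>
    if p == idx0 i then if q == idx0 i then cos (t * u) else if q == idx1 i then - sin (t * u) else 0
    else if p == idx1 i then if q == idx0 i then sin (t * u) else if q == idx1 i then cos (t * u) else 0
    else (p == q)%:R by apply/funext => u; rewrite mxE.
case: (eqVneq q (idx0 i)) => [->|q0]; last case: (eqVneq q (idx1 i)) => [->|q1].
all: case: (eqVneq p (idx0 i)) => [p0|p0]; rewrite ?p0 ?eqxx ?idx_neq.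
- by apply: (is_derive_eq dc); rewrite mulr0.
- case: (p == idx1 i); first by apply: (is_derive_eq ds); rewrite mulr1.
  by apply: (is_derive_eq (d0 _)); rewrite mulr0.
- by apply: (is_derive_eq dn); rewrite mulr1.
- case: (p == idx1 i); first by apply: (is_derive_eq dc); rewrite mulr0 oppr0.
  by apply: (is_derive_eq (d0 _)); rewrite mulr0 oppr0.
- exact: d0.
- exact: d0.
Qed.

(** [f] satisfies the linear equation [f' = f X], so [f(u) R_i(- t u)] has zero
    derivative. *)
Lemma rotation_ode (f : R -> 'M[R]_n.+1) i (t : R) : f 0 = 1%:M ->
  (forall u v, f (u + v) = f u *m f v) -> is_derive (0 : R) 1 f (t *: so_gen i) ->
  forall u, f u = plane_rot i (t * u).
Proof.
move=> f0 fD /is_derive_mx df.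
have df' (u : R) p q : is_derive u 1 (fun v => f v p q) ((f u *m (t *: so_gen i)) p q).
  have -> : (fun v => f v p q) = \sum_(r < n.+1) (f u p r *: ((fun y : R => f y r q) \o (fun v => v - u))).
    by apply/funext => v; rewrite fct_sumE -{1}(subrKC u v) fD mxE.
  rewrite mxE; apply: is_derive_sum => r; apply: is_deriveZ.
  rewrite -[X in is_derive _ _ _ X]mulr1; apply: is_derive1_comp.
    by rewrite subrr.
  exact: (is_derive_shift u 1 (- u)).
have cst p q (u : R) : (f u *m plane_rot i (- (t * u))) p q = (f 0 *m plane_rot i (- (t * 0))) p q.
  pose F u := (f u *m plane_rot i (- (t * u))) p q.
  apply: (is_derive_0_is_cst (f := F)) => {}u.
  have dc := is_derive_cos_mull t u; have ds := is_derive_sin_mull t u.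
  have dp j := df' u p j.
  have -> : F = fun v =>
      if q == idx0 i then f v p (idx0 i) * cos (t * v) - f v p (idx1 i) * sin (t * v)
      else if q == idx1 i then f v p (idx0 i) * sin (t * v) + f v p (idx1 i) * cos (t * v)
      else f v p q.
    apply/funext => v; rewrite /F mul_plane_mxE cosN sinN opprK.
    by case: ifP => // _; rewrite mulrN.
  case: (eqVneq q (idx0 i)) => [_|q0]; [|case: (eqVneq q (idx1 i)) => [_|q1]].
  - have D := is_deriveB (is_deriveM (dp (idx0 i)) dc) (is_deriveM (dp (idx1 i)) ds).
    apply: (is_derive_eq D); rewrite !mul_so_gen eqxx [idx1 i == _]eq_sym idx_neq eqxx.
    rewrite /GRing.scale /=; ring.
  - have D := is_deriveD (is_deriveM (dp (idx0 i)) ds) (is_deriveM (dp (idx1 i)) dc).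
    apply: (is_derive_eq D); rewrite !mul_so_gen eqxx [idx1 i == _]eq_sym idx_neq eqxx.
    rewrite /GRing.scale /=; ring.
  - by have := dp q; rewrite mul_so_gen (negbTE q0) (negbTE q1).
move=> u; have -> : f u = (f u *m plane_rot i (- (t * u))) *m plane_rot i (t * u).
  by rewrite -mulmxA plane_rotKN mulmx1.
have -> : f u *m plane_rot i (- (t * u)) = f 0 *m plane_rot i (- (t * 0)) by apply/matrixP => p q.
by rewrite f0 mul1mx mulr0 oppr0 plane_rot0 mul1mx.
Qed.

(** Both homomorphisms cover [R_i(t u)], so they agree near 0, where they take their
    values in the sheet; hence they agree everywhere, as [gam u] is the [N]-th power
    of [gam (u/N)]. *)
Lemma rotation_lift_unique i gam (t : R) gam' : is_rotation_lift i gam ->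
  one_parameter_subgroup Pi (t *: so_gen i) gam' -> forall u, gam' u = gam (t * u).
Proof.
move=> [cgam gamD Pgam] [cgam' gamD' d'].
have Pgam' u : Pi (gam' u) = plane_rot i (t * u).
  apply: (rotation_ode (f := Pi \o gam')) => //=.
    have E : (gam' 0 * gam' 0 = gam' 0)%g by rewrite -gamD' addr0.
    by rewrite (_ : gam' 0 = 1%g) ?cover1//; apply: (mulgI (gam' 0)); rewrite E mulg1.
  by move=> u' v; rewrite gamD' coverM.
have g0 : gam' 0 = 1%g.
  by apply: (mulgI (gam' 0)); rewrite -gamD' addr0 mulg1.
have h0 : gam 0 = 1%g.
  by apply: (mulgI (gam 0)); rewrite -gamD addr0 mulg1.
have [V [sct [oV V1 Vinj _ _]]] := local_section.
have : \forall u \near (0 : R), V (gam' u) /\ V (gam (t * u)).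
  near=> u; split; near: u.
    by apply: cgam'; rewrite g0; exact: open_nbhs_nbhs.
  have c : {for (0 : R), continuous (fun u => gam (t * u))}.
    apply: (@continuous_comp _ _ _ (fun u => t * u) gam); last exact: cgam.
    by apply: continuousM; [exact: cst_continuous|exact: cvg_id].
  by apply: c; rewrite mulr0 h0; exact: open_nbhs_nbhs.
move=> /nbhs_ballP[d /= d0 hd] u.
have [N [N0 uN]] := divN_lt u d0.
have E : gam' (u / N%:R) = gam (t * (u / N%:R)).
  have [] : V (gam' (u / N%:R)) /\ V (gam (t * (u / N%:R))).
    by apply: hd; rewrite /ball /= sub0r normrN.
  by move=> V1' V2'; apply: Vinj => //; rewrite Pgam Pgam'.
have X (g : R -> G) : g 0 = 1%g -> (forall s t, g (s + t) = (g s * g t)%g) ->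
    forall (v : R) M, g (M%:R * v) = (g v ^+ M)%g.
  move=> G0 GD v; elim=> [|M IH]; first by rewrite mul0r G0 expg0.
  by rewrite -natr1 mulrDl mul1r GD IH expgSr.
have N0' : N%:R != 0 :> R by rewrite pnatr_eq0 -lt0n.
have uE : u = N%:R * (u / N%:R) by rewrite mulrCA divff// mulr1.
by rewrite uE (X gam')// E (mulrCA t N%:R) (X gam).
Unshelve. all: by end_near. Qed.

(** [lie_exp] is an arbitrary choice among the values at 1 of the one-parameter
    subgroups with a given velocity: these exist and agree. *)
Lemma alphaP i : exists2 gam, is_rotation_lift i gam & forall t, alpha Pi i t = gam t.
Proof.
have [gam gamP] := rotation_lift_exists i; exists gam => // t.
have [cgam gamD Pgam] := gamP.
rewrite /alpha /lie_exp.
set S := [set x | _].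
have : S (xget 1%g S).
  apply: xgetPex; exists (gam t); exists (fun u => gam (t * u)); last by rewrite mulr1.
  split.
  - move=> u; apply: (@continuous_comp _ _ _ (fun u => t * u) gam); last exact: cgam.
    by apply: continuousM; [exact: cst_continuous|exact: cvg_id].
  - by move=> u v; rewrite mulrDr gamD.
  - rewrite (_ : _ \o _ = fun u => plane_rot i (t * u)); first exact: plane_rot_derive0.
    by apply/funext => u /=; rewrite Pgam.
by move=> [gam' hgam' <-]; rewrite (rotation_lift_unique gamP hgam') mulr1.
Qed.

End Lifting.

(** * The parametrization of the signed Bruhat cell *)

Section DiscreteKernel.
Context {G : topGroupType}.

(** [V] isolates the identity in [D], and the open translates [g V], which avoid the
    identity, cover the rest of [D]: the singleton is open and closed in [D]. *)
Lemma connected_discrete (K V D : set G) : open V -> V 1%g ->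
  (forall x y, K x -> K y -> K (x^-1 * y)%g) ->
  (forall x, K x -> V x -> x = 1%g) ->
  connected D -> D `<=` K -> D 1%g -> D = [set 1%g].
Proof.
move=> oV V1 KM KV cD DK D1; apply/esym; apply: cD; first by exists 1%g.
  exists V => //; apply/seteqP; split=> [x /= ->//|x [Dx Vx]].
  by apply: KV => //; exact: DK.
pose W := \bigcup_(g in K `&` [set g | g <> 1%g]) [set y | V (g^-1 * y)%g].
have K1 : K 1%g by exact: DK.
exists (~` W).
  apply: open_closedC; apply: bigcup_open => g _.
  have cg : continuous (fun y : G => (g^-1 * y)%g).
    by move=> y; apply: (@continuousMg _ _ (fun=> (g^-1)%g) id); [exact: cst_continuous|exact: cvg_id].
  exact: (open_comp (fun y _ => cg y) oV).
apply/seteqP; split=> [x /= ->|x [Dx Wx] /=].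
  split=> // -[g [Kg g1] /= Vg]; apply: g1.
  have g'1 : (g^-1 * 1)%g = 1%g by apply: KV => //; exact: KM.
  by apply: invg_inj; rewrite -[LHS]mulg1 g'1 invg1.
apply: contrapT => x1; apply: Wx; exists x; first by split=> //; exact: DK.
by rewrite /= mulVg.
Qed.

End DiscreteKernel.

Section Main.
Context {R : realType} {n : nat} {Spin : topGroupType} (Pi : Spin -> 'M[R]_n.+1).
Hypothesis hPi : universal_covering_hom Pi.
Variables (q : Spin) (hq : Quat Pi q).
Variables (k : nat) (w : 'I_k -> 'I_n) (hw : reduced_word w) (eps : 'I_k -> bool).

Let Psi (t : 'rV[R]_k) : Spin :=
  (q * \prod_(j < k) alpha Pi (w j) ((-1) ^+ eps j * t ord0 j)%R)%g.
Let center : 'rV[R]_k := \row_j (pi / 2).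
Let T := Pi @^-1` (Bruhat_cell (Pi (Psi center)) `&` @SO R n.+1).

Lemma Quat_monomial : exists sg, monomial_mx 1%g sg (Pi q).
Proof.
have [[[s hs] _] /is_diag_mxP dq] := hq.
have E j : exists e : R, e * e = 1 /\ forall p, Pi q j p = e * (j == p)%:R.
  have sj e : e != 0 -> (forall p, Pi q j p = e * (s j == p)%:R) -> s j = j.
    move=> e0 rj; apply/eqP; apply: contraT => sj.
    have := rj (s j); rewrite dq 1?eq_sym// eqxx mulr1 => /esym/eqP.
    by rewrite (negbTE e0).
  case: (hs j) => /rowP rj.
    have rj' p : Pi q j p = 1 * (s j == p)%:R.
      by have := rj p; rewrite !mxE eqxx /= mul1r eq_sym.
    exists 1; split=> [|p]; first by rewrite mulr1.
    by rewrite rj' (sj _ _ rj')// oner_neq0.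
  have rj' p : Pi q j p = (-1) * (s j == p)%:R.
    by have := rj p; rewrite !mxE eqxx /= mulN1r eq_sym.
  exists (-1); split=> [|p]; first by rewrite mulrNN mulr1.
  by rewrite rj' (sj _ _ rj')// oppr_eq0 oner_neq0.
exists (fun j => projT1 (cid (E j))) => j.
have [e1 eq] := projT2 (cid (E j)); split=> // p.
by rewrite eq perm1.
Qed.

Lemma Pi_Psi t : Pi (Psi t) = rot_prod w eps (Pi q) (fun j => t ord0 j).
Proof.
rewrite /Psi (coverM hPi) (cover_prod hPi) /rot_prod; congr (_ *m _).
apply: eq_bigr => j _; have [gam [_ _ Pgam] ->] := alphaP hPi (w j).
exact: Pgam.
Qed.

Lemma Psi_center : Psi center =
  (q * \prod_(j < k) sign_pow (acute Pi (w j)) (eps j))%g.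
Proof.
rewrite /Psi; congr (_ * _)%g; apply: eq_bigr => j _.
rewrite mxE /sign_pow /acute; have [gam [_ gamD _] gE] := alphaP hPi (w j).
rewrite !gE; case: (eps j); rewrite ?expr0 ?expr1 ?mul1r// mulN1r.
have g0 : gam 0 = 1%g by apply: (mulgI (gam 0)); rewrite -gamD addr0 mulg1.
by apply: (mulIg (gam (pi / 2))); rewrite -gamD addNr g0 mulVg.
Qed.

Lemma Pi_Psi_center : Pi (Psi center) = rot_prod w eps (Pi q) (fun=> pi / 2).
Proof.
by rewrite Pi_Psi; congr rot_prod; apply/funext => j; rewrite mxE.
Qed.

Lemma Psi_continuous : continuous Psi.
Proof.
move=> t; apply: continuousMg; first exact: cst_continuous.
apply: continuous_prodg => j; have [gam [cgam _ _] gE] := alphaP hPi (w j).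
rewrite (_ : (fun y : 'rV[R]_k => _) = fun y => gam ((-1) ^+ eps j * y ord0 j)%R); last first.
  by apply/funext => y; rewrite gE.
apply: (@continuous_comp _ _ _ (fun y : 'rV[R]_k => (-1) ^+ eps j * y ord0 j) gam); last exact: cgam.
by apply: continuousM; [exact: cst_continuous|exact: coord_continuous].
Qed.

Lemma Psi_T t : cube t -> T (Psi t).
Proof.
have [sg hsg] := Quat_monomial.
move=> ct; split; last exact: cover_SO.
by rewrite Pi_Psi_center Pi_Psi; exact: rot_prod_cell hsg hw ct.
Qed.

(** The set [T] is the inverse image of the whole cell; [Psi] reaches every fibre over
    it, though not every point. *)
Lemma T_Psi y : T y -> exists2 t, cube t & Pi (Psi t) = Pi y.
Proof.
have [sg hsg] := Quat_monomial.
move=> [cy [oy _]]; rewrite Pi_Psi_center in cy.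
have [th thpi E] := rot_prod_surj hsg oy cy.
exists (\row_j th j); first by move=> j; rewrite mxE.
by rewrite Pi_Psi E; congr rot_prod; apply/funext => j; rewrite mxE.
Qed.

Lemma local_inverse z : T z -> exists (O : set 'M[R]_n.+1) (h : 'M[R]_n.+1 -> 'rV[R]_k),
  [/\ open O, O (Pi z), smooth_on O h &
    forall t, cube t -> O (Pi (Psi t)) -> h (Pi (Psi t)) = t].
Proof.
have [sg hsg] := Quat_monomial.
move=> [cz _]; rewrite Pi_Psi_center in cz.
have [Om [h [oO Oz hs hE]]] := rot_prod_local_inverse hsg hw cz.
exists Om, (fun A => \row_j h j A); split=> //.
  move=> m; apply: Ck_on_mx => // a b.
  by apply: Ck_on_eq (hs b m) => // A _; rewrite mxE.
by move=> t ct; rewrite Pi_Psi => Ot; apply/rowP => j; rewrite mxE hE.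
Qed.

Lemma PiPsi_inj t t' : cube t -> cube t' -> Pi (Psi t) = Pi (Psi t') -> t = t'.
Proof.
move=> ct ct' E; have [Om [h [oO Oz _ hE]]] := local_inverse (Psi_T ct).
by rewrite -(hE t)// -(hE t')// -E.
Qed.

(** Only the projection of [y] matters: [angles] inverts [Pi \o Psi]. *)
Let angles (y : Spin) : 'rV[R]_k := xget 0 [set t | cube t /\ Pi (Psi t) = Pi y].

Lemma anglesP y : T y -> cube (angles y) /\ Pi (Psi (angles y)) = Pi y.
Proof. by move=> /T_Psi[t ct E]; apply: (@xgetI _ 0 [set t | cube t /\ Pi (Psi t) = Pi y] t). Qed.

Lemma anglesK t : cube t -> angles (Psi t) = t.
Proof. by move=> ct; have [ca E] := anglesP (Psi_T ct); exact: PiPsi_inj. Qed.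

Lemma angles_smooth : smooth_from Pi T angles.
Proof.
move=> z Tz; have [Om [h [oO Oz hs hE]]] := local_inverse Tz.
exists (Pi @^-1` Om), Om, h; split=> //.
  by apply: (cover_continuous hPi); exact: open_nbhs_nbhs.
move=> x Ox; split=> // Tx; have [cx E] := anglesP Tx.
by rewrite -[in RHS]E hE// E.
Qed.

Lemma angles_continuous : {within T, continuous angles}.
Proof.
apply/subspace_continuousP => z Tz.
have [N [Om [h [Nz oO hs NE]]]] := angles_smooth Tz.
have Nz' := nbhs_singleton Nz.
have [Oz zE] := NE _ Nz'.
have ch : h (Pi x) @[x --> z] --> h (Pi z).
  by apply: (@continuous_comp _ _ _ Pi h); [exact: cover_continuous|exact: (hs 0%N)].
suff : angles @ within T (nbhs z) --> h (Pi z) by rewrite -(zE Tz).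
move=> W hW; have hW' : \forall x \near z, W (h (Pi x)) := ch _ hW.
suff H : \forall x \near z, T x -> W (angles x) by exact: H.
by apply: filterS2 Nz hW' => x Nx hx Tx; have [_ ->] := NE x Nx.
Qed.

Lemma center_cube : cube center.
Proof. move=> j; rewrite mxE; have := pi_gt0 R; lra. Qed.

(** The image of a segment of the cube is a connected set that contains the base
    point. *)
Lemma Psi_Bru t : cube t -> Bru Pi (Psi center) (Psi t).
Proof.
move=> ct; pose seg (u : R) := Psi (center + u *: (t - center)).
have cI : connected `[(0 : R), 1] by exact: segment_connected.
have cseg : {within `[(0 : R), 1], continuous seg}.
  have cs : continuous (fun u : R => center + u *: (t - center)).
    by move=> u; apply: cvgD; [exact: cvg_cst|apply: cvgZr_tmp; exact: cvg_id].
  have cs' : continuous seg.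
    move=> u; have := continuous_comp (cs u) (Psi_continuous (x := center + u *: (t - center))).
    exact.
  exact: continuous_subspaceT.
have cS := connected_continuous_connected cI cseg.
have S0 : (seg @` `[0, 1]) (Psi center).
  by exists 0; [rewrite /= in_itv /= lexx ler01|rewrite /seg scale0r addr0].
have S1 : (seg @` `[0, 1]) (Psi t).
  by exists 1; [rewrite /= in_itv /= lexx ler01|rewrite /seg scale1r subrKC].
apply: (connected_component_max S0 _ cS) => // _ [u /= u01 <-].
apply: Psi_T => j; rewrite !mxE; have := ct j.
move: u01; rewrite in_itv /= => /andP[u0 u1] /andP[t0 tp].
have := pi_gt0 R; nra.
Qed.

(** The defect [kappa y] between [y] and the point of the image of [Psi] in its fibre
    is constant on the component, because the kernel of [Pi] is discrete. *)
Lemma Bru_Psi y : Bru Pi (Psi center) y -> exists2 t, cube t & Psi t = y.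
Proof.
pose C := Bru Pi (Psi center).
have Tc : T (Psi center) by apply: Psi_T; exact: center_cube.
have CT : C `<=` T by exact: connected_component_sub.
have C1 : C (Psi center) by exact: connected_component_refl.
pose kappa y := (y * (Psi (angles y))^-1)%g.
have ckappa : {within C, continuous kappa}.
  apply: (continuous_subspaceW CT); apply/subspace_continuousP => z Tz.
  have ca : angles @ within T (nbhs z) --> angles z by exact: (subspace_continuousP _ _).1 angles_continuous z Tz.
  have cp : (Psi \o angles) @ within T (nbhs z) --> Psi (angles z).
    by apply: continuous_cvg ca; exact: Psi_continuous.
  have ci : ((fun x : Spin => x^-1)%g \o (Psi \o angles)) @ within T (nbhs z) --> (Psi (angles z))^-1%g.
    by apply: continuous_cvg cp; exact: invg_continuous.
  have cz : y @[y --> within T (nbhs z)] --> z by exact: cvg_within.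
  have cp2 : (fun y => (y, ((Psi (angles y))^-1)%g)) @ within T (nbhs z) -->
      (z, ((Psi (angles z))^-1)%g) by exact: cvg_pair cz ci.
  have c3 := @continuous_cvg _ _ _ (within T (nbhs z)) _ _
    (fun p : Spin * Spin => (p.1 * p.2)%g) _ (@mulg_continuous Spin _) cp2.
  exact: c3.
have [V [sct [oV V1 Vinj _ _]]] := local_section hPi.
have kappaC : kappa @` C = [set 1%g].
  apply: (@connected_discrete _ [set x | Pi x = 1%:M] V) => //.
  - move=> x x' /= x1 x'1; rewrite (coverM hPi) x'1 mulmx1.
    have := coverM hPi x^-1%g x; rewrite mulVg (cover1 hPi) x1 mulmx1 => <- //.
  - by move=> x /= x1 Vx; apply: Vinj => //; rewrite x1 (cover1 hPi).
  - apply: connected_continuous_connected ckappa; exact: component_connected.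
  - move=> _ [x Cx <-] /=; rewrite /kappa (coverM hPi).
    have [_ E] := anglesP (CT _ Cx); rewrite -E -(coverM hPi) mulgV.
    exact: cover1.
  - exists (Psi center) => //; rewrite /kappa anglesK ?mulgV//; exact: center_cube.
move=> Cy; exists (angles y); first by have [] := anglesP (CT _ Cy).
have : (kappa @` C) (kappa y) by exists y.
rewrite kappaC /= /kappa => E; apply: (mulIg (Psi (angles y))^-1%g).
by rewrite mulgV E.
Qed.

Lemma Psi_smooth : smooth_on (@cube R k) (Pi \o Psi).
Proof.
have oT := @openT 'rV[R]_k.
move=> m; apply: (@Ck_on_sub _ _ _ _ setT) => //.
have -> : Pi \o Psi = fun t => rot_prod w eps (Pi q) (fun j => t ord0 j).
  by apply/funext => t /=; rewrite Pi_Psi.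
apply: Ck_on_mx => // a b.
apply: Ck_on_mulmx => //; first by move=> x y; exact: Ck_on_cst.
elim: (index_enum _) => [|j r IH] x y.
  apply: (Ck_on_eq oT _ (@Ck_on_cst _ _ R m setT ((1 : 'M[R]_n.+1) x y) oT)) => t _.
  by rewrite big_nil.
apply: (@Ck_on_eq _ _ _ _ _ (fun t : 'rV[R]_k => (plane_rot (w j) ((-1) ^+ eps j * t ord0 j) *m
  \prod_(j0 <- r) plane_rot (w j0) ((-1) ^+ eps j0 * t ord0 j0)) x y)) => //.
  by move=> t _; rewrite big_cons.
apply: Ck_on_mulmx => //; apply: Ck_on_rot => //; apply: Ck_onM => //.
  exact: Ck_on_cst.
exact: Ck_on_coord.
Qed.

Lemma Psi_diffeomorphism : diffeomorphism_onto Pi (@cube R k)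
  (Bru Pi (Psi center)) Psi.
Proof.
split.
- split.
  + by move=> t; exact: Psi_Bru.
  + move=> t t'; rewrite !inE => ct ct' E; apply: PiPsi_inj => //; by rewrite E.
  + by move=> y /Bru_Psi[t ct <-]; exists t.
- split; last exact: Psi_smooth.
  by move=> t _; exact: Psi_continuous.
- exists angles; first exact: anglesK.
  move=> z Bz; have Tz : T z by exact: connected_component_sub Bz.
  have [N [Om [h [Nz oO hs NE]]]] := angles_smooth Tz.
  exists N, Om, h; split=> // x Nx; have [Ox E] := NE x Nx; split=> // Bx.
  by apply: E; exact: connected_component_sub Bx.
Qed.

End Main.

Theorem corollary1p2 (R : realType) (n : nat) (hn : (2 <= n)%N)
    (Spin : topGroupType) (Pi : Spin -> 'M[R]_n.+1)
    (hPi : universal_covering_hom Pi)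
    (q : Spin) (hq : Quat Pi q)
    (k : nat) (w : 'I_k -> 'I_n) (hw : reduced_word w)
    (eps : 'I_k -> bool) :
  diffeomorphism_onto Pi (@cube R k)
    (Bru Pi (q * \prod_(j < k) sign_pow (acute Pi (w j)) (eps j))%g)
    (fun t : 'rV[R]_k =>
       (q * \prod_(j < k) alpha Pi (w j) ((-1) ^+ eps j * t ord0 j)%R)%g).
Proof.
rewrite -(Psi_center hPi q w eps); exact: Psi_diffeomorphism.
Qed.
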